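(* The finite energy Hilbert space $\mathcal H_E$ of the symmetric measure $\rho$ admits the orthogonal decomposition $$\mathcal H_E=\overline{\mathcal D_{\mathrm{fin}}(\mu)}\oplus \mathcal{H}arm_E ,$$ where the closure of $\mathcal D_{\mathrm{fin}}(\mu)$ is taken in the norm of $\mathcal H_E$.
   Context: Setting. $(V,\mathcal B)$ is an uncountable standard Borel space, $\mu$ a non-atomic $\sigma$-finite positive Borel measure on it. $\rho$ is a $\sigma$-finite positive measure on $(V\times V,\mathcal B\times\mathcal B)$ which is symmetric, $\rho(A\times B)=\rho(B\times A)$ for all $A,B\in\mathcal B$, and which disintegrates as $\rho(f)=\int_V\int_V f(x,y)\,d\rho_x(y)\,d\mu(x)$ for a measurable field of measures $x\mapsto\rho_x$ on $(V,\mathcal B)$. $\mathcal B_{\mathrm{fin}}(\mu)=\{A\in\mathcal B:\mu(A)<\infty\}$. Assumption 1: $c(x):=\rho_x(V)$ satisfies $0<c(x)<\infty$ for $\mu$-a.e. $x$ and $\int_A c\,d\mu<\infty$ for all $A\in\mathcal B_{\mathrm{fin}}(\mu)$. The measure $\rho$ is irreducible: for the kernels $k^1(x,A)=\rho_x(A)$, $k^n(x,A)=\int_V k^{n-1}(y,A)\,\rho_x(dy)$, for every $A$ with $\mu(A)>0$ and $\mu$-a.e. $x$ there is $n$ with $k^n(x,A)>0$. Energy space. $\mathcal H_E$ is the space of Borel functions $f:V\to\mathbb R$ with $\iint (f(x)-f(y))^2\,d\rho(x,y)<\infty$, functions differing by a constant ($\mu$-a.e.) being identified, with inner product $\langle f,g\rangle_{\mathcal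 H_E}=\frac12\iint_{V\times V}(f(x)-f(y))(g(x)-g(y))\,d\rho(x,y)$; it is a Hilbert space. Assumption 2: all functions in $\mathcal H_E$ are locally square integrable, $\int_A f^2\,d\mu<\infty$ for $A\in\mathcal B_{\mathrm{fin}}(\mu)$. $\mathcal D_{\mathrm{fin}}(\mu)=\mathrm{Span}\{\chi_A:A\in\mathcal B_{\mathrm{fin}}(\mu)\}$, viewed inside $\mathcal H_E$. The graph Laplace operator is $\Delta f(x)=\int_V(f(x)-f(y))\,d\rho_x(y)$. $\mathcal{H}arm_E=\{h\in\mathcal H_E:\Delta h=0\ \mu\text{-a.e.}\}$. *)

(* Defs.v *)
From HB Require Import structures.
From mathcomp Require Import all_boot all_order all_algebra.
From mathcomp Require Import all_classical all_reals all_analysis.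
From mathcomp Require Import measurable_realfun.
Set Implicit Arguments.
Unset Strict Implicit.
Unset Printing Implicit Defensive.
Import Order.TTheory GRing.Theory Num.Theory.
Import numFieldNormedType.Exports.
Local Open Scope classical_set_scope.
Local Open Scope ring_scope.

(* [V] is Borel isomorphic to a Polish space: a Hausdorff complete
   pseudometric space is a complete metric space, and for these second
   countability is separability. *)
Definition standard_borel (R : realType) (d : measure_display)
    (V : measurableType d) : Prop :=
  exists (T : completePseudoMetricType R) (f : V -> T),
    [/\ hausdorff_space T, @second_countable T, bijective f &
        forall A : set V,
          measurable A <-> exists2 B, <<s @open T >> B & A = f @^-1` B].

Section MeasureData.
Context {R : realType} {d : measure_display} {V : measurableType d}.
Implicit Types (mu : {measure set V -> \bar R})
  (rho : {measure set (V * V) -> \bar R}) (k : R.-ker V ~> V).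

Definition nonatomic mu : Prop :=
  forall A, measurable A -> (0 < mu A)%E ->
    exists B, [/\ measurable B, B `<=` A, (0 < mu B)%E & (mu B < mu A)%E].

Definition symmetric_measure rho : Prop :=
  forall A B, measurable A -> measurable B -> rho (A `*` B) = rho (B `*` A).

Definition disintegrates rho mu k : Prop :=
  forall f : V * V -> \bar R, measurable_fun [set: V * V] f ->
    (forall z, (0 <= f z)%E) ->
    (\int[rho]_z f z = \int[mu]_x \int[k x]_y f (x, y))%E.

Definition finite_sets mu : set (set V) :=
  [set A | measurable A /\ (mu A < +oo)%E].

Definition locally_finite_degree mu k : Prop :=
  {ae mu, forall x, (0 < k x setT)%E /\ (k x setT < +oo)%E} /\
  forall A, finite_sets mu A -> (\int[mu]_(x in A) k x setT < +oo)%E.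

(* Indices are shifted: [kernel_iter k n] is $k^{n+1}$. *)
Fixpoint kernel_iter k (n : nat) (x : V) (A : set V) : \bar R :=
  match n with
  | 0%N => k x A
  | m.+1 => (\int[k x]_y kernel_iter k m y A)%E
  end.

Definition irreducible_kernel mu k : Prop :=
  forall A, measurable A -> (0 < mu A)%E ->
    {ae mu, forall x, exists n, (0 < kernel_iter k n x A)%E}.

End MeasureData.

(* Elements of the energy space are handled through representatives, i.e.
   functions [V -> R]; equality in the energy space is [energy_eq mu], and
   subsets of the energy space are the sets of representatives that are
   saturated for [energy_eq mu] (see [energy_subspace]). *)
Section EnergySpace.
Context {R : realType} {d : measure_display} {V : measurableType d}.
Implicit Types (mu : {measure set V -> \bar R})
  (rho : {measure set (V * V) -> \bar R}) (k : R.-ker V ~> V)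
  (f g h : V -> R) (S T : set (V -> R)).

Definition energy_space rho : set (V -> R) :=
  [set f : V -> R | measurable_fun [set: V] f /\
           (\int[rho]_z ((f z.1 - f z.2) ^+ 2)%:E < +oo)%E].

Definition energy_eq mu f g : Prop :=
  exists c : R, {ae mu, forall x, f x - g x = c}.

Definition energy_inner rho f g : R :=
  2^-1 * \int[rho]_z ((f z.1 - f z.2) * (g z.1 - g z.2)).

Definition energy_norm rho f : R := Num.sqrt (energy_inner rho f f).

Definition locally_square_integrable mu f : Prop :=
  forall A, finite_sets mu A -> (\int[mu]_(x in A) ((f x) ^+ 2)%:E < +oo)%E.

Definition Dfin mu : set (V -> R) :=
  [set f : V -> R | exists (n : nat) (a : 'I_n -> R) (A : 'I_n -> set V),
     (forall i, finite_sets mu (A i)) /\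
     f = (fun x => \sum_(i < n) a i * \1_(A i) x)].

Definition energy_closure rho S : set (V -> R) :=
  [set f : V -> R | energy_space rho f /\
     forall e : R, 0 < e ->
       exists2 g, (S `&` energy_space rho) g & energy_norm rho (f \- g) < e].

(* Extended-real valued, so that [laplacian k f x = 0] cannot hold merely
   because the integral diverges. *)
Definition laplacian k f (x : V) : \bar R :=
  (\int[k x]_y (f x - f y)%:E)%E.

Definition harmonic_energy mu rho k : set (V -> R) :=
  [set h : V -> R | energy_space rho h /\ {ae mu, forall x, laplacian k h x = 0%E}].

Definition energy_subspace mu rho S : Prop :=
  [/\ S `<=` energy_space rho,
      S (fun=> 0),
      forall (a : R) f g, S f -> S g -> S (fun x => a * f x + g x) &
      forall f g, S f -> energy_space rho g -> energy_eq mu f g -> S g].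

Definition orthogonal_decomposition mu rho S T : Prop :=
  [/\ energy_subspace mu rho S,
      energy_subspace mu rho T,
      forall g h, S g -> T h -> energy_inner rho g h = 0,
      forall f, energy_space rho f ->
        exists g h, [/\ S g, T h & energy_eq mu f (g \+ h)] &
      forall g h g' h', S g -> T h -> S g' -> T h' ->
        energy_eq mu (g \+ h) (g' \+ h') ->
        energy_eq mu g g' /\ energy_eq mu h h'].

End EnergySpace.

(* Main.v *)
(* With grad f (x, y) = f x - f y, the energy is half the squared L^2(rho) norm of
   grad f. By symmetry of rho and disintegration, the inner product of h with the
   indicator of A is the integral over A of the Laplacian of h; so h is harmonic iff
   it is orthogonal to D_fin.

   To project f on the closure of D_fin, take a minimizing sequence g_n in D_fin,
   which is Cauchy, with summable increments. The set where
   s = sum_n |g_(n+1) - g_n| is finite is not left by rho, hence by irreducibility it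
   is null or conull. If s is finite a.e., then g_n converges a.e. to the projection.
   If s is infinite a.e., the functions min(s_n / K, 1) built from the partial sums
   s_n have energy norm O(1/K) and tend to 1, so by cutting off and truncating every
   function of finite energy lies in the closure of D_fin. *)

Require Import Defs.
From HB Require Import structures.
From mathcomp Require Import all_boot all_order all_algebra.
From mathcomp Require Import all_classical all_reals all_analysis.
From mathcomp Require Import measurable_realfun.
From mathcomp Require Import ring lra.
Set Implicit Arguments.
Unset Strict Implicit.
Unset Printing Implicit Defensive.
Import Order.TTheory GRing.Theory Num.Theory.
Import numFieldNormedType.Exports.
Local Open Scope classical_set_scope.
Local Open Scope ring_scope.

(** That the gradients of the g_n converge in L^2(rho) does not say that the limit is again a
    gradient: the g_n are controlled only up to constants, which may drift. This is why s is studied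
    pointwise. If the series of |grad (g_(n+1) - g_n)| converges at a pair (x, y), finiteness of s
    at x passes to y, and the series converges at rho-almost every pair because the norms of its
    terms are summable. When s is infinite the drift is harmless: the closure is then the whole
    space, and f is its own projection. The g_n are chosen minimizing up to 4^(-n). The
    parallelogram law turns this into increments of order 2^(-n), and a discriminant turns it into
    orthogonality of f - g_n to D_fin up to 2^(-n). Irreducibility acts once more in the uniqueness
    of the decomposition: if grad u = 0 holds rho-a.e., every level set of u is null or conull, so u
    is constant. *)

(** Serves both the Cauchy-Schwarz inequality and the near-orthogonality of near-minimizers. There
    [a] is the square of a seminorm and may vanish, so the affine case is included. *)
Lemma quadratic_ge0_discriminant (R : realFieldType) (a b c : R) : 0 <= a ->
  (forall t, 0 <= a * t ^+ 2 + 2 * b * t + c) -> b ^+ 2 <= a * c.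
Proof.
rewrite le_eqVlt => /predU1P[<- h|a0 h]; last first.
  have := h (- b / a).
  have -> : a * (- b / a) ^+ 2 + 2 * b * (- b / a) + c = (a * c - b ^+ 2) / a.
    by field; exact: lt0r_neq0.
  by rewrite pmulr_lge0 ?invr_gt0// subr_ge0.
rewrite mul0r; suff -> : b = 0 by rewrite expr0n.
(* At this point the affine function [2 * b * t + c] takes the value -1. *)
apply/eqP/contraT => b0; have := h (- (c + 1) / (2 * b)).
have -> : 2 * b * (- (c + 1) / (2 * b)) = - (c + 1) by field.
by rewrite mul0r add0r; lra.
Qed.

(** A map with slopes in [0, 1] has a complement [x - phi x] with slopes in [0, 1]. The first bound
    controls truncations of a function, the second what the truncation removes. *)
Lemma nonexpansive_dist (R : realDomainType) (phi : R -> R) (a b : R) :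
  (forall x y, x <= y -> 0 <= phi y - phi x <= y - x) ->
  `|phi a - phi b| <= `|a - b| /\ `|(a - phi a) - (b - phi b)| <= `|a - b|.
Proof.
move=> h; have [ab|/ltW ba] := leP a b.
  have /andP[h1 h2] := h _ _ ab.
  rewrite distrC [`|a - b|]distrC [`|_ - (b - _)|]distrC [`|b - a|]ger0_norm ?subr_ge0//.
  by rewrite !ler_norml; split; lra.
have /andP[h1 h2] := h _ _ ba.
by rewrite [`|a - b|]ger0_norm ?subr_ge0// !ler_norml; split; lra.
Qed.

Lemma min_nonexpansive (R : realDomainType) (c x y : R) : x <= y ->
  0 <= Num.min y c - Num.min x c <= y - x.
Proof.
by move=> xy; rewrite !minEle; have [h1|h1] := leP y c; have [h2|h2] := leP x c; lra.
Qed.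

Lemma clamp_nonexpansive (R : realDomainType) (c x y : R) : x <= y ->
  0 <= Num.max (- c) (Num.min y c) - Num.max (- c) (Num.min x c) <= y - x.
Proof.
move=> /(min_nonexpansive c)/andP[]; move: (Num.min y c) (Num.min x c) => u v.
by rewrite !maxEle; have [h1|h1] := leP (- c) u; have [h2|h2] := leP (- c) v; lra.
Qed.

(** * The space of square integrable functions *)

Section SquareIntegrable.
Context {R : realType} {d : measure_display} {T : measurableType d}.
Variable m : {measure set T -> \bar R}.
Implicit Types F G H : T -> R.

Definition L2 F : Prop :=
  measurable_fun setT F /\ (\int[m]_z ((F z) ^+ 2)%:E < +oo)%E.
Definition ip F G : R := \int[m]_z (F z * G z).
Definition nrm F : R := Num.sqrt (ip F F).

Lemma measurable_sqrE F : measurable_fun setT F ->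
  measurable_fun setT (fun z => ((F z) ^+ 2)%:E).
Proof. by move=> mF; apply/measurable_EFinP; exact: measurable_funX. Qed.

Lemma L2_le F G : measurable_fun setT F -> (forall z, `|F z| <= `|G z|) ->
  L2 G -> L2 F.
Proof.
move=> mF FG [mG iG]; split=> //; apply: le_lt_trans iG.
apply: ge0_le_integral => //; try exact: measurable_sqrE.
- by move=> z _; rewrite lee_fin sqr_ge0.
- by move=> z _; rewrite lee_fin -[leLHS]real_normK ?num_real// -[leRHS]real_normK
   ?num_real// lerXn2r ?nnegrE.
Qed.

Lemma L2_mul_integrable F G : L2 F -> L2 G ->
  m.-integrable setT (EFin \o (fun z => F z * G z)).
Proof.
move=> [mF iF] [mG iG]; apply/integrableP; split.
  by apply/measurable_EFinP; exact: measurable_funM.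
apply: (@le_lt_trans _ _ (\int[m]_z (((F z) ^+ 2)%:E + ((G z) ^+ 2)%:E))%E).
  apply: ge0_le_integral => //.
  - apply: measurableT_comp => //; apply/measurable_EFinP; exact: measurable_funM.
  - by apply: emeasurable_funD; exact: measurable_sqrE.
  - move=> z _ /=; rewrite -EFinD lee_fin ler_norml; apply/andP; split; nra.
rewrite ge0_integralD//; try exact: measurable_sqrE.
- exact: lte_add_pinfty.
- by move=> z _; rewrite lee_fin sqr_ge0.
- by move=> z _; rewrite lee_fin sqr_ge0.
Qed.

(** The shape [a * F z + G z] is the single linear operation used throughout: sums, differences and
    multiples are all rewritten into it, sometimes with a factor [1] or [- 1]. *)
Lemma L2_comb a F G : L2 F -> L2 G -> L2 (fun z => a * F z + G z).
Proof.
move=> [mF iF] [mG iG].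
have mC : measurable_fun setT (fun z => a * F z + G z).
  by apply: measurable_funD => //; exact: measurable_funM.
split=> //.
apply: (@le_lt_trans _ _ (\int[m]_z ((2 * a ^+ 2)%:E * ((F z) ^+ 2)%:E
    + 2%:E * ((G z) ^+ 2)%:E))%E).
  apply: ge0_le_integral => //.
  - by move=> z _; rewrite lee_fin sqr_ge0.
  - exact: measurable_sqrE.
  - by apply: emeasurable_funD; apply: measurable_funeM; exact: measurable_sqrE.
  - move=> z _ /=; rewrite -!EFinM -EFinD lee_fin.
    have := sqr_ge0 (a * F z - G z); nra.
have a2 : 0 <= 2 * a ^+ 2 by rewrite mulr_ge0// sqr_ge0.
have sq0 (K : T -> R) z : (0 <= (K z ^+ 2)%:E)%E by rewrite lee_fin sqr_ge0.
have mule (b : R) (K : T -> R) : measurable_fun setT (fun z => (b%:E * ((K z) ^+ 2)%:E)%E)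
   = measurable_fun setT (fun z => (b * (K z) ^+ 2)%:E).
  by [].
rewrite ge0_integralD//; last 4 first.
- by move=> z _; rewrite mule_ge0.
- by apply: measurable_funeM; exact: measurable_sqrE.
- by move=> z _; rewrite mule_ge0.
- by apply: measurable_funeM; exact: measurable_sqrE.
rewrite !ge0_integralZl//; try exact: measurable_sqrE.
by apply: lte_add_pinfty; rewrite lte_mul_pinfty.
Qed.

Lemma ipC F G : ip F G = ip G F.
Proof. by apply: eq_Rintegral => z _; rewrite mulrC. Qed.

Lemma ip_comb a F G H : L2 F -> L2 G -> L2 H ->
  ip (fun z => a * F z + G z) H = a * ip F H + ip G H.
Proof.
move=> LF LG LH; rewrite /ip -RintegralZl//; last exact: L2_mul_integrable.
rewrite -RintegralD//; last 2 first.
- by apply: (@integrableZl _ _ _ m setT measurableT a (EFin \o (fun z => F z * H z)));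
    exact: L2_mul_integrable.
- exact: L2_mul_integrable.
by apply: eq_Rintegral => z _; rewrite mulrDl mulrA.
Qed.

Lemma ip_ge0 F : 0 <= ip F F.
Proof. by apply: Rintegral_ge0 => z _; rewrite -expr2 sqr_ge0. Qed.

Lemma nrm_ge0 F : 0 <= nrm F.
Proof. exact: sqrtr_ge0. Qed.

Lemma nrm_sqr F : nrm F ^+ 2 = ip F F.
Proof. by rewrite sqr_sqrtr// ip_ge0. Qed.

Lemma integral_sqrE F : L2 F -> (\int[m]_z ((F z) ^+ 2)%:E)%E = (nrm F ^+ 2)%:E.
Proof.
move=> [mF iF]; rewrite nrm_sqr /ip /Rintegral fineK; last first.
  rewrite ge0_fin_numE.
    by under eq_integral do rewrite -expr2.
  by apply: integral_ge0 => z _; rewrite lee_fin -expr2 sqr_ge0.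
by apply: eq_integral => z _; rewrite expr2.
Qed.

Lemma nrm_leP F C : measurable_fun setT F -> 0 <= C ->
  (\int[m]_z ((F z) ^+ 2)%:E <= (C ^+ 2)%:E)%E -> L2 F /\ nrm F <= C.
Proof.
move=> mF C0 iFC; have LF : L2 F by split=> //; apply: le_lt_trans iFC (ltry _).
split=> //; move: iFC; rewrite integral_sqrE// lee_fin.
by rewrite ler_pXn2r// ?nnegrE ?nrm_ge0.
Qed.

Lemma nrm_le F G : measurable_fun setT F -> (forall z, `|F z| <= `|G z|) ->
  L2 G -> nrm F <= nrm G.
Proof.
move=> mF FG LG; have LF := L2_le mF FG LG.
apply: (nrm_leP _ _ _).2 => //; first exact: nrm_ge0.
rewrite -integral_sqrE//; apply: ge0_le_integral => //.
- by move=> z _; rewrite lee_fin sqr_ge0.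
- exact: measurable_sqrE.
- by apply: measurable_sqrE; case: LG.
- by move=> z _; rewrite lee_fin -[leLHS]real_normK ?num_real// -[leRHS]real_normK
   ?num_real// lerXn2r ?nnegrE.
Qed.

Lemma ip_combr a F G H : L2 F -> L2 G -> L2 H ->
  ip H (fun z => a * F z + G z) = a * ip H F + ip H G.
Proof. by move=> *; rewrite ipC ip_comb// ![ip _ H]ipC. Qed.

Lemma ip_comb_sqr a F G : L2 F -> L2 G ->
  ip (fun z => a * F z + G z) (fun z => a * F z + G z) =
  a ^+ 2 * ip F F + 2 * a * ip F G + ip G G.
Proof.
move=> LF LG; rewrite ip_comb//; last exact: L2_comb.
by rewrite !ip_combr// (ipC G F); ring.
Qed.

Lemma cauchy_schwarz F G : L2 F -> L2 G -> `|ip F G| <= nrm F * nrm G.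
Proof.
move=> LF LG.
rewrite -(ler_pXn2r (ltn0Sn 1)) ?nnegrE ?mulr_ge0 ?nrm_ge0//.
rewrite exprMn !nrm_sqr real_normK ?num_real//.
apply: quadratic_ge0_discriminant; first exact: ip_ge0.
by move=> t; have := ip_ge0 (fun z => t * F z + G z); rewrite ip_comb_sqr//; lra.
Qed.

Lemma nrm_scaleD a F G : L2 F -> L2 G ->
  nrm (fun z => a * F z + G z) <= `|a| * nrm F + nrm G.
Proof.
move=> LF LG.
have aF0 : 0 <= `|a| * nrm F + nrm G by rewrite addr_ge0 ?mulr_ge0 ?nrm_ge0.
rewrite -(ler_pXn2r (ltn0Sn 1)) ?nnegrE ?nrm_ge0//.
rewrite nrm_sqr ip_comb_sqr// sqrrD exprMn !nrm_sqr real_normK ?num_real//.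
have : a * ip F G <= `|a| * (nrm F * nrm G).
  by rewrite (le_trans (ler_norm _))// normrM ler_wpM2l// cauchy_schwarz.
by rewrite mulr2n; lra.
Qed.

Lemma L2_cst0 : L2 (fun=> 0).
Proof.
split; first exact: measurable_cst.
by under eq_integral do rewrite expr0n; rewrite integral0.
Qed.

Lemma ip0l F : ip (fun=> 0) F = 0.
Proof.
rewrite /ip; under eq_Rintegral do rewrite mul0r.
by rewrite /Rintegral integral0.
Qed.

Lemma nrm_cst0 : nrm (fun=> 0) = 0.
Proof. by rewrite /nrm ip0l sqrtr0. Qed.

Lemma nrm_scale a F : L2 F ->
  L2 (fun z => a * F z) /\ nrm (fun z => a * F z) <= `|a| * nrm F.
Proof.
move=> LF; rewrite (_ : (fun z => a * F z) = fun z => a * F z + 0).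
  split; first exact: L2_comb LF L2_cst0.
  by have := nrm_scaleD a LF L2_cst0; rewrite nrm_cst0 addr0.
by apply/funext => z; rewrite addr0.
Qed.

Lemma ip_scale a F : L2 F -> ip (fun z => a * F z) (fun z => a * F z) = a ^+ 2 * ip F F.
Proof.
move=> LF; rewrite /ip -RintegralZl//; last exact: L2_mul_integrable.
by apply: eq_Rintegral => z _; ring.
Qed.

Lemma parallelogram F G : L2 F -> L2 G ->
  ip (fun z => - 1 * G z + F z) (fun z => - 1 * G z + F z) =
  2 * ip F F + 2 * ip G G -
  4 * ip (fun z => 2^-1 * (1 * G z + F z)) (fun z => 2^-1 * (1 * G z + F z)).
Proof.
by move=> LF LG; rewrite ip_scale ?ip_comb_sqr//; [field|exact: L2_comb].
Qed.

Lemma ae_eq_L2 F G : L2 F -> measurable_fun setT G -> {ae m, forall z, F z = G z} ->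
  L2 G /\ forall H, L2 H -> ip G H = ip F H.
Proof.
move=> LF mG FG; have [mF iF] := LF; split.
  split=> //; rewrite -(ge0_ae_eq_integral (f := fun z => ((F z) ^+ 2)%:E))//.
  - exact: measurable_sqrE.
  - exact: measurable_sqrE.
  - by move=> z _; rewrite lee_fin sqr_ge0.
  - by move=> z _; rewrite lee_fin sqr_ge0.
  - by apply: filterS FG => z + _ => ->.
move=> H [mH _]; rewrite /ip /Rintegral; congr fine.
apply: ae_eq_integral => //; try by apply/measurable_EFinP; exact: measurable_funM.
by apply: filterS FG => z + _ => ->.
Qed.

Lemma nrm0_ae F : L2 F -> nrm F = 0 -> {ae m, forall z, F z = 0}.
Proof.
move=> LF F0; have [mF _] := LF; have := integral_sqrE LF; rewrite F0 expr0n/= => i0.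
have [/(_ _)] := ae_eq_integral_abs m measurableT (measurable_sqrE mF).
have -> : (\int[m]_z `|((F z) ^+ 2)%:E|)%E = 0%E.
  by apply: etrans i0; apply: eq_integral => z _; rewrite gee0_abs// lee_fin sqr_ge0.
move=> /(_ erefl) h _; apply: filterS h => z /(_ Logic.I)/= [] /eqP.
by rewrite sqrf_eq0 => /eqP.
Qed.

(** Lower semicontinuity of the norm, by Fatou applied to the squares. It lets an estimate pass to a
    limit that is known only pointwise almost everywhere. *)
Lemma nrm_fatou (F_ : nat -> T -> R) F C : 0 <= C -> (forall n, L2 (F_ n)) ->
  (forall n, nrm (F_ n) <= C) -> measurable_fun setT F ->
  {ae m, forall z, F_ n z @[n --> \oo] --> F z} -> L2 F /\ nrm F <= C.
Proof.
move=> C0 LF FC mF cvgF; apply: nrm_leP => //.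
apply: (@le_trans _ _ (\int[m]_z (limn_einf (fun n => ((F_ n z) ^+ 2)%:E)))%E).
  apply: ae_ge0_le_integral => //.
  - by move=> z _; rewrite lee_fin sqr_ge0.
  - exact: measurable_sqrE.
  - move=> z _; rewrite limn_einf_lim; apply: lime_ge; first exact: is_cvg_einfs.
    apply: nearW => n; apply: le_ereal_inf_tmp => _ [k _ <-].
    by rewrite lee_fin sqr_ge0.
  - apply: measurableT_comp => //; apply: measurable_fun_limn_esup => n.
    by apply: measurableT_comp => //; apply: measurable_sqrE; exact: (LF n).1.
  apply: filterS cvgF => z cz _.
  have c2 : ((F_ n z) ^+ 2)%:E @[n --> \oo] --> ((F z) ^+ 2)%:E.
    apply: cvg_EFin; first exact: nearW.
    exact: (cvgM cz cz).
  by have [-> _] := cvg_limn_einf_sup c2.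
apply: le_trans (fatou _ _ _ _) _ => //.
- by move=> n; apply: measurable_sqrE; exact: (LF n).1.
- by move=> n z _; rewrite lee_fin sqr_ge0.
rewrite limn_einf_lim; apply: lime_le; first exact: is_cvg_einfs.
apply: nearW => n; apply: (@le_trans _ _ (\int[m]_z ((F_ n z) ^+ 2)%:E)%E).
  by apply: ereal_inf_lbound; exists n => /=.
rewrite integral_sqrE// lee_fin lerXn2r// ?nnegrE ?nrm_ge0//.
Qed.

Lemma nrm_dominated (F_ : nat -> T -> R) G : L2 G ->
  (forall n, measurable_fun setT (F_ n)) -> (forall n z, `|F_ n z| <= `|G z|) ->
  {ae m, forall z, F_ n z @[n --> \oo] --> 0} -> nrm (F_ n) @[n --> \oo] --> 0.
Proof.
move=> LG mF FG cF.
have LF n : L2 (F_ n) by exact: L2_le (mF n) (FG n) LG.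
have [] := @dominated_convergence _ T R m setT measurableT
  (fun n z => ((F_ n z) ^+ 2)%:E) (cst 0%E) (fun z => ((G z) ^+ 2)%:E).
- by move=> n; exact: measurable_sqrE.
- exact: measurable_cst.
- apply: filterS cF => z cz _; apply: cvg_EFin; first exact: nearW.
  rewrite -[0](expr0n _ 2).
  exact: (cvgM cz cz).
- have := L2_mul_integrable LG LG; exact: eq_integrable.
- apply: aeW => z n _ /=; rewrite lee_fin ger0_norm ?sqr_ge0//.
  by rewrite -[leLHS]real_normK ?num_real// -[leRHS]real_normK
   ?num_real// lerXn2r ?nnegrE.
move=> _ _; rewrite integral0 => c.
have c1 : ((nrm (F_ n)) ^+ 2) @[n --> \oo] --> 0.
  have /fine_cvg := c; apply: cvg_trans; apply: near_eq_cvg.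
  by apply: nearW => n /=; rewrite integral_sqrE.
have -> : (fun n => nrm (F_ n)) = (fun n => Num.sqrt ((nrm (F_ n)) ^+ 2)).
  by apply/funext => n; rewrite sqrtr_sqr ger0_norm ?nrm_ge0.
have := continuous_cvg _ (@sqrt_continuous R 0) c1; rewrite sqrtr0; exact.
Qed.

(** The argument of Riesz and Fischer: the partial sums of the [|F_ i|] have norm at most [C] by the
    triangle inequality, so by monotone convergence the limit of their squares is integrable, hence
    finite a.e. *)
Lemma L2_summable_ae (F_ : nat -> T -> R) C : (forall n, L2 (F_ n)) ->
  (forall n, \sum_(i < n) nrm (F_ i) <= C) ->
  {ae m, forall z, exists M, forall n, \sum_(i < n) `|F_ i z| <= M}.
Proof.
move=> LF FC.
pose S n z := \sum_(i < n) `|F_ i z|.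
have mS n : measurable_fun setT (S n).
  apply: measurable_sum => i; apply: measurableT_comp => //; exact: (LF i).1.
have LS n : L2 (S n) /\ nrm (S n) <= \sum_(i < n) nrm (F_ i).
  elim: n => [|n [L h]].
    rewrite big_ord0 (_ : S 0%N = fun=> 0) ?nrm_cst0; first by split=> //; exact: L2_cst0.
    by apply/funext => z; rewrite /S big_ord0.
  have SE : S n.+1 = (fun z => 1 * S n z + `|F_ n z|).
    by apply/funext => z; rewrite /S big_ord_recr/= mul1r.
  have mN : measurable_fun setT (fun z => `|F_ n z|).
    by apply: measurableT_comp => //; exact: (LF n).1.
  have le z : `| `|F_ n z| | <= `|F_ n z| by rewrite normr_id.
  have LN := L2_le mN le (LF n).
  rewrite SE; split; first exact: L2_comb.
  apply: le_trans (nrm_scaleD _ L LN) _; rewrite normr1 mul1r big_ord_recr/=.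
  by apply: lerD => //; exact: nrm_le.
have C0 : 0 <= C by have := FC 0%N; rewrite big_ord0.
have S0 n z : 0 <= S n z by apply: sumr_ge0.
have ndS z : {homo (S ^~ z) : a b / (a <= b)%N >-> a <= b}.
  by apply: homo_leq => // [y x w|n]; [exact: le_trans|rewrite /S big_ord_recr/= lerDl].
pose g n z := ((S n z) ^+ 2)%:E.
have nd z : {homo (g ^~ z) : a b / (a <= b)%N >-> (a <= b)%E}.
  by move=> a b ab; rewrite lee_fin lerXn2r ?nnegrE//; exact: ndS.
have mg n : measurable_fun setT (g n) by exact: measurable_sqrE.
have := @cvg_monotone_convergence _ T R m setT measurableT g mg
  (fun n z _ => sqr_ge0 (S n z)) (fun z _ => nd z).
move=> /cvg_lim => /(_ _) h.
have ilt : (\int[m]_z (limn (g ^~ z)) < +oo)%E.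
  rewrite -h//; apply: (@le_lt_trans _ _ (C ^+ 2)%:E); last exact: ltry.
  apply: lime_le.
    apply: ereal_nondecreasing_is_cvgn => a b ab; apply: ge0_le_integral => //.
    - by move=> z _; rewrite lee_fin sqr_ge0.
    - by move=> z _; exact: nd.
  apply: nearW => n; rewrite integral_sqrE; last exact: (LS n).1.
  by rewrite lee_fin lerXn2r ?nnegrE ?nrm_ge0// (le_trans (LS n).2).
have lim0 z : (0 <= limn (g ^~ z))%E.
  apply: lime_ge; first exact: ereal_nondecreasing_is_cvgn.
  by apply: nearW => n; rewrite lee_fin sqr_ge0.
have ig : m.-integrable setT (fun z => limn (g ^~ z)).
  apply/integrableP; split.
    apply: (emeasurable_fun_cvg _ _ mg) => z _.
    exact: ereal_nondecreasing_is_cvgn.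
  by under eq_integral do rewrite gee0_abs//.
apply: filterS (integrable_ae measurableT ig) => z /(_ Logic.I) fz.
(* It is the squares that are bounded by their limit; [S <= 1 + S ^+ 2] brings the bound back to
   [S]. *)
exists (1 + fine (limn (g ^~ z))) => n.
rewrite -/(S n z); apply: (@le_trans _ _ (1 + S n z ^+ 2)).
  by have := sqr_ge0 (S n z - 1); have := S0 n z; nra.
rewrite lerD2l -lee_fin fineK//.
apply: lime_ge; first exact: ereal_nondecreasing_is_cvgn.
by exists n => // k; exact: nd.
Qed.

End SquareIntegrable.

(** * Disintegration and irreducibility *)

Section FiniteDegreePart.
Import HBNNSimple.
Context {R : realType} {d : measure_display} {V : measurableType d}.
Context (k : R.-ker V ~> V).

(* Slice integrals are known to be measurable only for kernels of finite measures;
   the points of infinite degree form a null set, so they can be discarded. *)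
Definition kfin (x : V) : {measure set V -> \bar R} :=
  if (k x setT < +oo)%E then k x else mzero.

Lemma measurable_kfin U : measurable U -> measurable_fun [set: V] (kfin ^~ U).
Proof.
move=> mU.
rewrite (_ : kfin ^~ U = fun x => if (k x setT < +oo)%E then k x U else 0%E).
  apply: measurable_fun_ifT => //; last exact: measurable_kernel.
  by apply: measurable_fun_lte => //; exact: measurable_kernel.
by apply/funext => x; rewrite /kfin; case: ifP.
Qed.

HB.instance Definition _ := isKernel.Build _ _ _ _ _ kfin measurable_kfin.

Lemma measurable_integral_kfin (f : V * V -> \bar R) : measurable_fun setT f ->
  (forall z, (0 <= f z)%E) -> measurable_fun setT (fun x => \int[kfin x]_y f (x, y))%E.
Proof.
move=> mf f0; pose f_ := nnsfun_approx measurableT mf.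
apply: (measurable_fun_xsection_integral f kfin f_).
- by move=> a b ab; exact/nd_nnsfun_approx.
- by move=> z; exact/cvg_nnsfun_approx.
move=> n r; set A := _ @^-1` _.
have mA : measurable A by exact: measurable_sfunP.
(* A strict bound common to all measurable sets is required, hence the total mass plus 1.
   Restricting to [measurableT] changes nothing and only fits the form expected below. *)
have kb x : exists M, forall X, measurable X -> (mrestr (kfin x) measurableT X < M%:E)%E.
  have ltk : (kfin x setT < +oo)%E by rewrite /kfin; case: ifP => // _; exact: ltry.
  exists (fine (kfin x setT) + 1) => X mX; rewrite /mrestr setIT.
  apply: (@le_lt_trans _ _ (kfin x setT)); first by apply: le_measure; rewrite ?inE.
  rewrite EFinD fineK; last by rewrite ge0_fin_numE.
  by rewrite lteDl ?lte01// ge0_fin_numE.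
have [_] := measurable_prod_subset_xsection_kernel kb mA.
by under eq_fun do rewrite /mrestr setIT.
Qed.

End FiniteDegreePart.

Section Disintegration.
Context {R : realType} {d : measure_display} {V : measurableType d}.
Context (mu : {measure set V -> \bar R}) (rho : {measure set (V * V) -> \bar R})
  (k : R.-ker V ~> V).
Context (mu_sigma_finite : sigma_finite [set: V] mu)
  (rho_symmetric : symmetric_measure rho)
  (rho_disintegrates : disintegrates rho mu k)
  (degree_locally_finite : locally_finite_degree mu k)
  (rho_irreducible : irreducible_kernel mu k).

Lemma rho_setX A B : measurable A -> measurable B ->
  rho (A `*` B) = (\int[mu]_(x in A) k x B)%E.
Proof.
move=> mA mB; have mAB := measurableX mA mB.
rewrite -[A `*` B]setIT -integral_indic// rho_disintegrates; last 2 first.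
- by apply/measurable_EFinP.
- by move=> z; rewrite lee_fin.
rewrite [RHS]integral_mkcond; apply: eq_integral => x _; rewrite patchE.
case: ifPn => xA.
  transitivity (\int[k x]_y (\1_B y)%:E)%E; last by rewrite integral_indic// setIT.
  apply: eq_integral => y _.
  by rewrite !indicE in_setX/= xA.
by apply: integral0_eq => y _; rewrite indicE in_setX/= (negbTE xA).
Qed.

Lemma rho_null_fst N : measurable N -> mu N = 0%E -> rho (N `*` setT) = 0%E.
Proof.
move=> mN N0; rewrite rho_setX// null_set_integral//.
by apply: measurable_funTS; exact: measurable_kernel.
Qed.

(** Both marginals of [rho] are absolutely continuous with respect to [mu]: the first by
    disintegration, the second by symmetry. *)
Lemma ae_pair (P : V -> Prop) : {ae mu, forall x, P x} ->
  {ae rho, forall z, P z.1 /\ P z.2}.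
Proof.
move=> [N [mN N0 PN]].
exists ((N `*` setT) `|` (setT `*` N)); split.
- by apply: measurableU; exact: measurableX.
- have m1 : measurable (N `*` setT : set (V * V)) by exact: measurableX.
  have m2 : measurable (setT `*` N : set (V * V)) by exact: measurableX.
  have n1 : rho (N `*` setT) = 0%E by exact: rho_null_fst.
  have n2 : rho (setT `*` N) = 0%E by rewrite rho_symmetric.
  exact: null_set_setU.
- move=> [x y]/= /not_andP[nP|nP]; [left|right]; split=> //; exact: PN.
Qed.

(** For a null set [N], the integral of [k x N] is [rho (setT]*[N)], which by symmetry is
    [rho (N]*[setT) = 0]. *)
Lemma ae_kernel (P : V -> Prop) : {ae mu, forall x, P x} ->
  {ae mu, forall x, {ae k x, forall y, P y}}.
Proof.
move=> [N [mN N0 PN]].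
have : (\int[mu]_x `|k x N| = 0)%E.
  under eq_integral do rewrite gee0_abs//.
  by rewrite -rho_setX// rho_symmetric// rho_null_fst.
move/(ae_eq_integral_abs mu measurableT (measurable_kernel k N mN)).
by apply: filterS => x /(_ Logic.I) kN0; exists N.
Qed.

Lemma measurable_kernel_iter n A : measurable A ->
  measurable_fun [set: V] (fun x => kernel_iter k n x A) /\
  forall x, (0 <= kernel_iter k n x A)%E.
Proof.
move=> mA; elim: n => [|n [mn n0]] /=.
  by split=> //; exact: measurable_kernel.
split=> [|x]; last exact: integral_ge0.
apply: (measurable_fun_integral_kernel (l := k)) => // U mU.
exact: measurable_kernel.
Qed.

(** Almost every point outside [B] gives no mass to [B] in one step, hence by induction in any
    number of steps: the first step stays outside [B]. If [B] has positive measure, irreducibility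
    then leaves almost no point outside it. *)
Lemma ergodic B : measurable B -> rho (~` B `*` B) = 0%E ->
  mu B = 0%E \/ mu (~` B) = 0%E.
Proof.
move=> mB B0; have mCB := measurableC mB.
have k1 : {ae mu, forall x, ~ B x -> k x B = 0%E}.
  have : (\int[mu]_(x in ~` B) `|k x B| = 0)%E.
    by under eq_integral do rewrite gee0_abs//; rewrite -rho_setX.
  have mk : measurable_fun (~` B) (fun x => k x B).
    by apply: measurable_funTS; exact: measurable_kernel.
  by move/(ae_eq_integral_abs mu mCB mk).
have kn n : {ae mu, forall x, ~ B x -> kernel_iter k n x B = 0%E}.
  elim: n => [//|n IH] /=.
  apply: filterS2 k1 (ae_kernel IH) => x kx aex nBx.
  have [mn n0] := measurable_kernel_iter n mB.
  rewrite (ae_eq_integral (cst 0%E)) ?integral0//.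
  have aeB : {ae k x, forall y, ~ B y}.
    by exists B; split=> //; [exact: kx|move=> y /= /contrapT].
  by apply: filterS2 aeB aex => y nBy h _; exact: h.
have [->|muB0] := eqVneq (mu B) 0%E; first by left.
right; apply/negligibleP => //.
have muB : (0 < mu B)%E by rewrite lt0e muB0 measure_ge0.
have [N [mN N0 sN]] : {ae mu, forall x, B x}.
  apply: filterS2 (ae_foralln kn) (rho_irreducible mB muB) => x h [n].
  apply: contraPP => nBx; rewrite h//; apply/negP.
  by rewrite ltxx.
by exists N.
Qed.

(** Almost no pair goes from [u <= t] to [t < u], so [ergodic] makes each set [t < u] null or
    conull. The constant is the threshold between the two regimes. *)
Lemma ae_pair_const u : measurable_fun [set: V] u ->
  {ae rho, forall z, u z.1 = u z.2} -> exists c : R, {ae mu, forall x, u x = c}.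
Proof.
move=> mfu uE.
have mB t : measurable [set x | t < u x].
  have := @emeasurable_fun_o_infty _ V R setT (EFin \o u) measurableT.
  rewrite (_ : [set x | t < u x] = setT `&` [set x | t%:E < (EFin \o u) x]%E).
    by apply; exact/measurable_EFinP.
  by rewrite setTI.
have erg t : mu [set x | t < u x] = 0%E \/ mu (~` [set x | t < u x]) = 0%E.
  apply: ergodic => //; apply/negligibleP.
    by apply: measurableX => //; exact: measurableC.
  have [N [mN N0 sN]] := uE; exists N; split=> //.
  move=> z /= [h1 h2]; apply: sN => /= e; apply: h1 => /=; rewrite e; exact: h2.
(* For the zero measure every level set is conull and the supremum below would not exist. *)
have [mu0|muN0] := eqVneq (mu setT) 0%E.
  by exists 0; exact: measure0_ae.
pose S := [set t : R | mu (~` [set x | t < u x]) = 0%E].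
have mC t : measurable (~` [set x | t < u x]) by exact: measurableC.
have dec t s : s <= t -> S t -> S s.
  move=> st; rewrite /S/= => St; apply: (subset_measure0 _ _ _ St) => // x /=.
  by apply: contra_not; exact: le_lt_trans.
(* If no level set were conull, all would be null, and the sets [- n%:R < u x] would cover the space
   by null sets. Boundedness of [S] is the same argument with complements. *)
have S0 : exists t, S t.
  apply: contrapT => nS; move/eqP: muN0; apply.
  have -> : setT = \bigcup_n [set x | - n%:R < u x].
    apply/esym; rewrite -subTset => x _; exists (Num.truncn `|u x|).+1 => //=.
    rewrite ltrNl (le_lt_trans _ (truncnS_gt _))//.
    by rewrite -normrN ler_norm.
  apply/negligibleP; first exact: bigcupT_measurable.
  apply: negligible_bigcup => n; apply/negligibleP => //.
  by have [//|h] := erg (- n%:R); case: nS; exists (- n%:R).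
have ubS : exists M, ubound S M.
  apply: contrapT => nM.
  have St t : S t.
    apply: contrapT => nSt; apply: nM; exists t => s Ss; rewrite leNgt.
    by apply/negP => ts; apply: nSt; apply: dec Ss; exact: ltW.
  move/eqP: muN0; apply.
  have -> : setT = \bigcup_n (~` [set x | n%:R < u x]).
    apply/esym; rewrite -subTset => x _; exists (Num.truncn `|u x|).+1 => //=.
    by apply/negP; rewrite -leNgt (le_trans (ler_norm _))// ltW// truncnS_gt.
  apply/negligibleP; first exact: bigcupT_measurable.
  by apply: negligible_bigcup => n; apply/negligibleP => //; exact: St.
have hS : has_sup S by [].
exists (sup S).
have lo : {ae mu, forall x, forall n, sup S - n.+1%:R^-1 < u x}.
  apply: ae_foralln => n.
  have : S (sup S - n.+1%:R^-1).
    have [|t St lt] := @sup_adherent _ S n.+1%:R^-1 _ hS; first by rewrite invr_gt0.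
    by apply: dec St; exact: ltW.
  by rewrite /S/= => h; exists (~` [set x | sup S - n.+1%:R^-1 < u x]); split.
have hi : {ae mu, forall x, forall n, ~ sup S + n.+1%:R^-1 < u x}.
  apply: ae_foralln => n.
  have [h|h] := erg (sup S + n.+1%:R^-1).
    exists [set x | sup S + n.+1%:R^-1 < u x]; split=> //.
    by move=> x /= /contrapT.
  have : sup S + n.+1%:R^-1 <= sup S by exact: ub_le_sup.
  by rewrite leNgt ltrDl invr_gt0 ltr0n.
apply: filterS2 lo hi => x lox hix; apply/eqP; rewrite eq_le; apply/andP; split.
  apply/ler_addgt0Pr => e e0; have [n ne] := @ltr_add_invr R 0 e e0.
  rewrite add0r in ne.
  have /negP := hix n; rewrite -leNgt => /le_trans; apply.
  by rewrite lerD2l ltW.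
apply/ler_addgt0Pr => e e0; have [n ne] := @ltr_add_invr R 0 e e0.
rewrite add0r in ne; rewrite -lerBlDr (le_trans _ (ltW (lox n)))//.
by rewrite lerD2l lerN2 ltW.
Qed.

(** * Symmetry of [rho] beyond rectangles, and measurable slice integrals *)

Lemma rho_finite_fst A : finite_sets mu A -> (rho (A `*` setT) < +oo)%E.
Proof.
by move=> fA; rewrite rho_setX//; [exact: degree_locally_finite.2|exact: fA.1].
Qed.

(** Symmetry is given on rectangles, a generating class stable under intersection. Uniqueness of
    measures extends it, the exhaustion being [F n]*[setT] with [mu (F n)] finite, of finite
    [rho]-measure because the degree is locally integrable. *)
Lemma rho_swap A : measurable A -> rho A = rho (unstable.swap @^-1` A).
Proof.
move=> mA.
have [F FT mF] := mu_sigma_finite.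
pose swp : V * V -> V * V := @unstable.swap V V.
have mswp : measurable_fun setT swp by exact: measurable_swap.
pose m2 : {measure set (V * V) -> \bar R} := pushforward rho swp.
rewrite -[RHS]/(m2 mswp A).
have m2E B : m2 mswp B = rho (swp @^-1` B) by [].
apply: (measure_unique [set A `*` B | A in measurable & B in measurable]
  (fun n => F n `*` setT)) => //.
- exact: measurable_prod_measurableType.
- move=> _ _ [X1 mX1 [X2 mX2 <-]] [Y1 mY1 [Y2 mY2 <-]].
  exists (X1 `&` Y1); first exact: measurableI.
  by exists (X2 `&` Y2); [exact: measurableI|rewrite setXI].
- by move=> n; exists (F n); [exact: (mF n).1|exists setT].
- by rewrite -setX_bigcupl -FT setXTT.
- move=> _ [X mX [Y mY <-]]; rewrite m2E rho_symmetric//.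
  by congr (rho _); apply/seteqP; split=> -[x y] [].
- by move=> n; apply: rho_finite_fst; exact: mF.
Qed.

Lemma integral_rho_swap (f : V * V -> \bar R) : measurable_fun setT f ->
  (forall z, (0 <= f z)%E) -> (\int[rho]_z f z = \int[rho]_z f (z.2, z.1))%E.
Proof.
move=> mf f0.
pose swp : V * V -> V * V := @unstable.swap V V.
have mswp : measurable_fun setT swp by exact: measurable_swap.
pose m2 : {measure set (V * V) -> \bar R} := pushforward rho swp.
rewrite (eq_measure_integral (m2 mswp)).
  by rewrite ge0_integral_pushforward.
by move=> A mA _; rewrite rho_swap.
Qed.

(** [P] is the slice integral against [kfin]: measurable everywhere, and equal to the slice integral
    against [k] off the null set of points of infinite degree. Only these properties are
    exported. *)
Lemma slice_integral (f : V * V -> \bar R) : measurable_fun setT f ->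
  (forall z, (0 <= f z)%E) ->
  exists P : V -> \bar R, [/\ measurable_fun setT P, forall x, (0 <= P x)%E,
    {ae mu, forall x, P x = \int[k x]_y f (x, y)}%E &
    forall A, measurable A ->
      (\int[rho]_z ((\1_A z.1)%:E * f z) = \int[mu]_(x in A) P x)%E].
Proof.
move=> mf f0.
pose P x := (\int[kfin k x]_y f (x, y))%E.
pose C := [set x | (k x setT < +oo)%E].
have mC : measurable C.
  have := @emeasurable_fun_infty_o _ V R setT (fun x => k x setT) measurableT.
  by move=> /(_ (measurable_kernel k setT measurableT) +oo%E); rewrite setTI.
have aeC : {ae mu, forall x, C x}.
  by apply: filterS degree_locally_finite.1 => x [].
have PC x : C x -> P x = (\int[k x]_y f (x, y))%E by rewrite /P /kfin => ->.
have PnC x : ~ C x -> P x = 0%E.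
  by move/negP/negbTE => Cx; rewrite /P /kfin Cx integral_measure_zero.
have m1 A : measurable A -> measurable_fun setT (fun z : V * V => (\1_A z.1)%:E : \bar R).
  move=> mA; apply/measurable_EFinP.
  by apply: (measurableT_comp (measurable_indic mA)); exact: measurable_fst.
exists P; split.
- exact: measurable_integral_kfin.
- by move=> x; exact: integral_ge0.
- by apply: filterS aeC => x Cx; exact: PC.
move=> A mA.
have mAC : measurable (A `&` C) by exact: measurableI.
(* Removing the points of infinite degree from [A] is harmless: they carry no [rho]-mass as first
   coordinates, and [P] vanishes there. *)
transitivity (\int[rho]_z ((\1_(A `&` C) z.1)%:E * f z))%E.
  apply: ge0_ae_eq_integral => //; try by apply: emeasurable_funM => //; exact: m1.
  - by move=> z _; rewrite mule_ge0// lee_fin.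
  - by move=> z _; rewrite mule_ge0// lee_fin.
  - apply: filterS (ae_pair aeC) => z [Cz _] _; rewrite !indicE in_setI.
    by rewrite (mem_set Cz) andbT.
rewrite rho_disintegrates; last 2 first.
- by apply: emeasurable_funM => //; exact: m1.
- by move=> z; rewrite mule_ge0// lee_fin.
rewrite [RHS]integral_mkcond; apply: eq_integral => x _; rewrite patchE /=.
rewrite indicE in_setI; case: ifPn => xA /=; last first.
  by apply: integral0_eq => y _; rewrite mul0e.
have [Cx|nCx] := pselect (C x).
  by rewrite (mem_set Cx) PC//; apply: eq_integral => y _; rewrite mul1e.
by rewrite memNset// PnC//; apply: integral0_eq => y _; rewrite mul0e.
Qed.

Lemma Rintegral_rho_swap (F : V * V -> R) : measurable_fun setT F ->
  \int[rho]_z F z = \int[rho]_z F (z.2, z.1).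
Proof.
move=> mF; rewrite /Rintegral; congr fine.
have mE : measurable_fun setT (EFin \o F) by exact/measurable_EFinP.
rewrite [LHS]integralE [RHS]integralE; congr (_ - _)%E.
- rewrite integral_rho_swap//; last exact: measurable_funepos.
  by apply: eq_integral => z _; rewrite !funeposE.
- rewrite integral_rho_swap//; last exact: measurable_funeneg.
  by apply: eq_integral => z _; rewrite !funenegE.
Qed.

(** * Gradients, and harmonicity as orthogonality to indicators *)

Definition grad (f : V -> R) (z : V * V) : R := f z.1 - f z.2.

Lemma measurable_grad f : measurable_fun setT f -> measurable_fun setT (grad f).
Proof.
by move=> mf; apply: measurable_funB; apply: measurableT_comp mf _;
  [exact: measurable_fst|exact: measurable_snd].
Qed.

Lemma energy_spaceP f : energy_space rho f <-> measurable_fun setT f /\ L2 rho (grad f).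
Proof.
split=> [[mf fE]|[mf [_ fE]]]; split=> //; split=> //.
exact: measurable_grad.
Qed.

Lemma energy_innerE f g : energy_inner rho f g = 2^-1 * ip rho (grad f) (grad g).
Proof. by []. Qed.

Lemma energy_normE f : energy_norm rho f = Num.sqrt 2^-1 * nrm rho (grad f).
Proof. by rewrite /energy_norm energy_innerE sqrtrM. Qed.

Lemma L2_indic_fst A : finite_sets mu A -> L2 rho (fun z => \1_A z.1).
Proof.
move=> fA; have mA := fA.1; split.
  by apply: (measurableT_comp (measurable_indic mA)); exact: measurable_fst.
have mAT : measurable (A `*` setT : set (V * V)) by exact: measurableX.
have := rho_finite_fst fA; congr (_ < _)%E.
rewrite -[A `*` setT]setIT -integral_indic//; apply: eq_integral => z _.
by rewrite !indicE in_setX in_setT andbT; case: (_ \in _); rewrite ?expr1n ?expr0n.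
Qed.

Lemma L2_swap F : L2 rho F -> L2 rho (fun z => F (z.2, z.1)).
Proof.
move=> [mF iF]; split.
  by apply: measurableT_comp mF _; exact: measurable_swap.
by rewrite -(integral_rho_swap (f := fun z => ((F z) ^+ 2)%:E))//;
  [exact: measurable_sqrE|move=> z; rewrite lee_fin sqr_ge0].
Qed.

Lemma grad_indicE A : grad \1_A = fun z => - 1 * \1_A z.2 + \1_A z.1.
Proof. by apply/funext => z; rewrite /grad mulN1r addrC. Qed.

(** The gradient of the indicator has two terms. Since [grad h] is antisymmetric, swapping the
    variables shows that they contribute equally, which absorbs the factor one half. *)
Lemma energy_inner_indicE A h : finite_sets mu A -> energy_space rho h ->
  energy_inner rho \1_A h = \int[rho]_z (\1_A z.1 * grad h z).
Proof.
move=> fA /energy_spaceP[mh Lh].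
have L1 := L2_indic_fst fA; have L1' := L2_swap L1.
rewrite energy_innerE grad_indicE ip_comb//=.
have -> : ip rho (fun z => \1_A z.2) (grad h) = - ip rho (fun z => \1_A z.1) (grad h).
  rewrite /ip Rintegral_rho_swap; last first.
    by apply: measurable_funM; [exact: L1'.1|exact: Lh.1].
  rewrite -[RHS]mulN1r -RintegralZl//; last exact: L2_mul_integrable.
  by apply: eq_Rintegral => z _ /=; rewrite /grad/=; ring.
by rewrite /ip; field.
Qed.

(** The positive and negative parts of [grad h] are sliced separately into [p] and [n]. Almost
    everywhere the Laplacian is [p x - n x], and on a set [A] of finite measure both are integrable,
    the inner product with its indicator being the difference of their integrals over [A]. *)
Lemma harmonicP h : energy_space rho h -> harmonic_energy mu rho k h <->
  forall A, finite_sets mu A -> energy_inner rho \1_A h = 0.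
Proof.
move=> Eh; have [mh Lh] := (energy_spaceP h).1 Eh.
pose D z := (grad h z)%:E.
have mD : measurable_fun setT D by apply/measurable_EFinP; exact: Lh.1.
have [p [mp p0 aep Ip]] := slice_integral (measurable_funepos mD) (funepos_ge0 D).
have [n [mn n0 aen In]] := slice_integral (measurable_funeneg mD) (funeneg_ge0 D).
have lapE : {ae mu, forall x, laplacian k h x = (p x - n x)%E}.
  apply: filterS2 aep aen => x -> ->; rewrite /laplacian integralE.
  by congr (_ - _)%E; apply: eq_integral => y _; rewrite !(funeposE, funenegE).
have iA A : finite_sets mu A -> mu.-integrable A p /\ mu.-integrable A n.
  move=> fA; have mA := fA.1.
  (* The indicator times [grad h] is a product of two square integrable functions; its absolute
     value dominates the weighted positive and negative parts. *)
  have /integrableP[_ ib] := L2_mul_integrable (L2_indic_fst fA) Lh.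
  split; apply/integrableP; split; try exact: measurable_funTS.
  - under eq_integral do rewrite gee0_abs//.
    rewrite -Ip//; apply: le_lt_trans ib; apply: ge0_le_integral => //.
    + by move=> z _; rewrite mule_ge0// ?lee_fin// funepos_ge0.
    + apply: emeasurable_funM; last exact: measurable_funepos.
      by apply/measurable_EFinP; exact: (L2_indic_fst fA).1.
    + apply: measurableT_comp => //; apply/measurable_EFinP/measurable_funM.
        exact: (L2_indic_fst fA).1.
      exact: Lh.1.
    + move=> z _ /=; rewrite normrM EFinM ger0_norm// lee_wpmul2l ?lee_fin//.
      by rewrite !funeposE /D -EFin_max lee_fin ge_max ler_norm normr_ge0.
  - under eq_integral do rewrite gee0_abs//.
    rewrite -In//; apply: le_lt_trans ib; apply: ge0_le_integral => //.
    + by move=> z _; rewrite mule_ge0// ?lee_fin// funeneg_ge0.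
    + apply: emeasurable_funM; last exact: measurable_funeneg.
      by apply/measurable_EFinP; exact: (L2_indic_fst fA).1.
    + apply: measurableT_comp => //; apply/measurable_EFinP/measurable_funM.
        exact: (L2_indic_fst fA).1.
      exact: Lh.1.
    + move=> z _ /=; rewrite normrM EFinM ger0_norm// lee_wpmul2l ?lee_fin//.
      rewrite !funenegE /D -EFinN -EFin_max lee_fin ge_max normr_ge0 andbT.
      by rewrite -normrN ler_norm.
have innE A : finite_sets mu A ->
    (energy_inner rho \1_A h)%:E = (\int[mu]_(x in A) p x - \int[mu]_(x in A) n x)%E.
  move=> fA; have mA := fA.1.
  rewrite energy_inner_indicE// /Rintegral fineK; last first.
    exact: integrable_fin_num (L2_mul_integrable (L2_indic_fst fA) Lh).
  rewrite integralE -Ip// -In//; congr (_ - _)%E; apply: eq_integral => z _.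
  - rewrite !funeposE /= /D !indicE; case: (_ \in _); rewrite ?mul1r ?mul1e//.
    by rewrite mul0r mul0e maxxx.
  - rewrite !funenegE /= /D !indicE; case: (_ \in _); rewrite ?mul1r ?mul1e//.
    by rewrite mul0r oppr0 mul0e maxxx.
split=> [[_ aeh] A fA|inn].
  apply/eqP; rewrite -eqe innE//; have mA := fA.1.
  have [ip_ in_] := iA A fA.
  rewrite (ae_eq_integral n) ?subee//; try exact: measurable_funTS.
    exact: integrable_fin_num.
  apply: filterS2 lapE aeh => x lx hx _.
  have := p0 x; have := n0 x; move: lx; rewrite hx.
  (* Since [+oo - +oo = -oo] for extended reals, a zero difference of nonnegative terms forces both
     to be finite, and equal. *)
  case: (p x) (n x) => [a| |] [b| |]//= /esym + _ _.
  by rewrite -EFinB => -[/eqP]; rewrite subr_eq0 => /eqP ->.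
split=> //.
have [F FT mF] := mu_sigma_finite.
(* On each piece of the exhaustion, [p] and [n] have equal integrals over every measurable
   subset. *)
have eqF j : ae_eq mu (F j) p n.
  have [ip_ in_] := iA _ (mF j).
  apply: integral_ae_eq => //; first exact: (mF j).1.
    exact: measurable_funTS.
  move=> E EF mE.
  have fE : finite_sets mu E.
    split=> //; apply: le_lt_trans (mF j).2.
    by apply: le_measure => //; rewrite inE//; exact: (mF j).1.
  have := innE E fE; rewrite inn// => /esym/eqP.
  have [ipE inE_] := iA E fE.
  rewrite -(fineK (integrable_fin_num mE ipE)) -(fineK (integrable_fin_num mE inE_)).
  by rewrite -EFinB eqe subr_eq0 => /eqP ->.
have finF j : {ae mu, forall x, F j x -> p x \is a fin_num}.
  by apply: integrable_ae; [exact: (mF j).1|exact: (iA _ (mF j)).1].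
apply: filterS3 lapE (ae_foralln eqF) (ae_foralln finF) => x -> pn pf.
have [j _ Fx] : (\bigcup_i F i) x by rewrite -FT.
by rewrite -(pn j Fx) subee//; exact: pf Fx.
Qed.

(** * Finite energy functions *)

Implicit Types (f g h v : V -> R).

(** This is sqrt 2 times the energy norm. Estimates are made with it, and the factor is paid once,
    in [energy_closureP]. *)
Local Notation en f := (nrm rho (grad f)).

Lemma grad_comb a f g : grad (fun x => a * f x + g x) = fun z => a * grad f z + grad g z.
Proof. by apply/funext => z; rewrite /grad; ring. Qed.

Lemma energy_comb a f g : energy_space rho f -> energy_space rho g ->
  energy_space rho (fun x => a * f x + g x).
Proof.
move=> /energy_spaceP[mf Lf] /energy_spaceP[mg Lg]; apply/energy_spaceP; split.
  by apply: measurable_funD => //; exact: measurable_funM.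
by rewrite grad_comb; exact: L2_comb.
Qed.

Lemma energy_sub f g : energy_space rho f -> energy_space rho g ->
  energy_space rho (f \- g).
Proof.
move=> Ef Eg; rewrite (_ : f \- g = fun x => - 1 * g x + f x).
  exact: energy_comb.
by apply/funext => x /=; ring.
Qed.

Lemma en_sub_trans f g h : energy_space rho f -> energy_space rho g ->
  energy_space rho h -> en (f \- h) <= en (f \- g) + en (g \- h).
Proof.
move=> Ef Eg Eh.
have /energy_spaceP[_ Lfg] := energy_sub Ef Eg.
have /energy_spaceP[_ Lgh] := energy_sub Eg Eh.
rewrite (_ : grad (f \- h) = fun z => 1 * grad (f \- g) z + grad (g \- h) z).
  by rewrite (le_trans (nrm_scaleD _ Lfg Lgh))// normr1 mul1r.
by apply/funext => z; rewrite /grad /=; ring.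
Qed.

Lemma energy_contraction f g : energy_space rho f -> measurable_fun setT g ->
  (forall x y, `|g x - g y| <= `|f x - f y|) -> energy_space rho g /\ en g <= en f.
Proof.
move=> /energy_spaceP[mf Lf] mg gf.
have mdg := measurable_grad mg.
have le z : `|grad g z| <= `|grad f z| by exact: gf.
split; last exact: nrm_le mdg le Lf.
by apply/energy_spaceP; split=> //; exact: L2_le mdg le Lf.
Qed.

Lemma energy_eq_grad f g : energy_eq mu f g -> {ae rho, forall z, grad f z = grad g z}.
Proof.
move=> [c fg]; apply: filterS (ae_pair fg) => z [h1 h2]; rewrite /grad.
by move: h1 h2; lra.
Qed.

Lemma grad0E : grad (fun=> 0) = fun=> 0.
Proof. by apply/funext => z; rewrite /grad subrr. Qed.

Lemma energy0 : energy_space rho (fun=> 0).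
Proof.
apply/energy_spaceP; split; first exact: measurable_cst.
by rewrite grad0E; exact: L2_cst0.
Qed.

(** * Simple functions and bounded functions of finite support *)

Lemma Dfin0 : Dfin mu (fun=> 0).
Proof.
exists 0%N, (fun=> 0), (fun=> set0); split=> [[]//|].
by apply/funext => x; rewrite big_ord0.
Qed.

Lemma Dfin_comb a f g : Dfin mu f -> Dfin mu g -> Dfin mu (fun x => a * f x + g x).
Proof.
move=> [n [b [A [fA ->]]]] [m [c [B [fB ->]]]].
exists (n + m)%N, (fun i => match fintype.split i with inl j => a * b j | inr j => c j end),
  (fun i => match fintype.split i with inl j => A j | inr j => B j end); split.
  by move=> i; case: fintype.split.
apply/funext => x; rewrite big_split_ord/= mulr_sumr; congr (_ + _).
  apply: eq_bigr => i _; rewrite -[lshift m i]/(unsplit (inl i)) unsplitK.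
  by rewrite mulrA.
by apply: eq_bigr => i _; rewrite -[rshift n i]/(unsplit (inr i)) unsplitK.
Qed.

Lemma Dfin_indic A : finite_sets mu A -> Dfin mu \1_A.
Proof.
move=> fA; exists 1%N, (fun=> 1), (fun=> A); split=> //.
by apply/funext => x; rewrite big_ord1 mul1r.
Qed.

(** A class between [Dfin] and its closure that, unlike [Dfin], is stable under multiplication by
    bounded measurable functions; the cutoffs of a general function land in it. *)
Definition bounded_finite_support g : Prop :=
  [/\ measurable_fun setT g, exists M, forall x, `|g x| <= M &
    exists2 A, finite_sets mu A & forall x, ~ A x -> g x = 0].

Lemma finite_setsU A B : finite_sets mu A -> finite_sets mu B ->
  finite_sets mu (A `|` B).
Proof.
move=> [mA fA] [mB fB]; split; first exact: measurableU.
by apply: le_lt_trans (measureU2 _ mA mB) _; rewrite lte_add_pinfty.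
Qed.

Lemma bfs_comb a f g : bounded_finite_support f -> bounded_finite_support g ->
  bounded_finite_support (fun x => a * f x + g x).
Proof.
move=> [mf [M fM] [A fA f0]] [mg [N gN] [B fB g0]]; split.
- by apply: measurable_funD => //; exact: measurable_funM.
- exists (`|a| * M + N) => x; apply: le_trans (ler_normD _ _) _.
  by rewrite normrM lerD// ler_wpM2l.
exists (A `|` B); first exact: finite_setsU.
by move=> x /not_orP[nA nB]; rewrite f0// g0// mulr0 addr0.
Qed.

Lemma bfs_indic A : finite_sets mu A -> bounded_finite_support \1_A.
Proof.
move=> fA; split; first exact: measurable_indic fA.1.
- by exists 1 => x; rewrite indicE; case: (_ \in _); rewrite ?normr1 ?normr0.
- by exists A => // x nA; rewrite indicE memNset.
Qed.

Lemma bfs0 : bounded_finite_support (fun=> 0).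
Proof.
split; first exact: measurable_cst.
- by exists 0 => x; rewrite normr0.
- by exists set0 => //; split=> //; rewrite measure0.
Qed.

Lemma Dfin_bfs f : Dfin mu f -> bounded_finite_support f.
Proof.
move=> [n [a [A [fA ->]]]].
elim: n a A fA => [|n IH] a A fA.
  by rewrite (_ : (fun x => _) = fun=> 0); [exact: bfs0|apply/funext => x; rewrite big_ord0].
rewrite (_ : (fun x => _) = fun x => a ord0 * \1_(A ord0) x +
  \sum_(i < n) a (lift ord0 i) * \1_(A (lift ord0 i)) x).
  by apply: bfs_comb; [exact: bfs_indic|apply: IH => i; exact: fA].
by apply/funext => x; rewrite big_ord_recl.
Qed.

(** Uniform smallness on a fixed set of finite measure gives small energy: [|g x - g y|] is at most
    [M] times the sum of the indicators of [A] at [x] and [y], which is square integrable. *)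
Lemma en_bound A M g : finite_sets mu A -> measurable_fun setT g -> 0 <= M ->
  (forall x, `|g x| <= M * \1_A x) ->
  energy_space rho g /\
  en g <= M * nrm rho (fun z => 1 * \1_A z.1 + \1_A z.2).
Proof.
move=> fA mg M0 gM.
have L1 := L2_indic_fst fA; have L1' := L2_swap L1.
have LS : L2 rho (fun z => 1 * \1_A z.1 + \1_A z.2) by exact: L2_comb L1 L1'.
have [LMS nMS] := nrm_scale M LS.
have le z : `|grad g z| <= `|M * (1 * \1_A z.1 + \1_A z.2)|.
  rewrite mul1r mulrDr [leRHS]ger0_norm ?addr_ge0 ?mulr_ge0//.
  by apply: le_trans (ler_normB _ _) _; rewrite lerD.
have mdg := measurable_grad mg.
split; first by apply/energy_spaceP; split=> //; exact: L2_le mdg le LMS.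
apply: le_trans (nrm_le mdg le LMS) _; apply: le_trans nMS _.
by rewrite ger0_norm.
Qed.

Lemma bfs_energy g : bounded_finite_support g -> energy_space rho g.
Proof.
move=> [mg [M gM] [A fA g0]].
apply: (@en_bound A `|M| g fA mg _ _).1 => // x; rewrite indicE.
have [Ax|nAx] := pselect (A x).
  by rewrite mem_set// mulr1 (le_trans (gM x))// ler_norm.
by rewrite memNset// g0// mulr0 normr0.
Qed.

Lemma energy_closureP f : energy_closure rho (Dfin mu) f <->
  energy_space rho f /\ forall e, 0 < e -> exists2 g, Dfin mu g & en (f \- g) < e.
Proof.
have s0 : 0 < Num.sqrt (2^-1 : R) by rewrite sqrtr_gt0 invr_gt0.
split=> -[Ef fe]; split=> // e e0.
  have [|g [Dg _] ge] := fe (Num.sqrt 2^-1 * e); first by rewrite mulr_gt0.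
  by exists g => //; move: ge; rewrite energy_normE ltr_pM2l.
have [|g Dg ge] := fe ((Num.sqrt 2^-1)^-1 * e); first by rewrite mulr_gt0 ?invr_gt0.
exists g; first by split=> //; exact: bfs_energy (Dfin_bfs Dg).
by rewrite energy_normE mulrC -ltr_pdivlMr// mulrC.
Qed.

Lemma closure_limit f : energy_space rho f ->
  (forall e, 0 < e -> exists2 g, energy_closure rho (Dfin mu) g & en (f \- g) < e) ->
  energy_closure rho (Dfin mu) f.
Proof.
move=> Ef fe; apply/energy_closureP; split=> // e e0.
have [|g /energy_closureP[Eg ge] fg] := fe (e / 2); first by rewrite divr_gt0.
have [|v Dv gv] := ge (e / 2); first by rewrite divr_gt0.
exists v => //; have Ev := bfs_energy (Dfin_bfs Dv).
by apply: le_lt_trans (en_sub_trans Ef Eg Ev) _; rewrite [ltRHS]splitr ltrD.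
Qed.

(** [g] is rounded down on [A] to a grid of step [1 / N]. The uniform error [1 / N] is converted
    into energy by [en_bound]. *)
Lemma bfs_closure g : bounded_finite_support g -> energy_closure rho (Dfin mu) g.
Proof.
move=> bg; have Eg := bfs_energy bg; have [mg [M gM] [A fA g0]] := bg.
apply/energy_closureP; split=> // e e0.
set K := nrm rho (fun z => 1 * \1_A z.1 + \1_A z.2).
have K0 : 0 <= K by exact: nrm_ge0.
(* Dividing by [K + 1] rather than [K] covers the case [K = 0]. *)
have [n] := @ltr_add_invr R 0 (e / (K + 1)) (divr_gt0 e0 (ltr_wpDl K0 ltr01)).
rewrite add0r => ne.
set N : R := n.+1%:R; have N0 : 0 < N by rewrite /N ltr0n.
pose m := (Num.truncn `|M|).+1.
have gm x : `|g x| < m%:R.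
  by apply: le_lt_trans (gM x) _; apply: le_lt_trans (ler_norm _) _; exact: truncnS_gt.
(* Index of the grid cell of [g x]. The shift by [m] makes the argument nonnegative, as [Num.truncn]
   requires, and [|g x| < m%:R] leaves [2 m N] cells. *)
pose q x := Num.truncn ((g x + m%:R) * N).
have q_ge0 x : 0 <= (g x + m%:R) * N.
  rewrite mulr_ge0 ?ltW// -(opprK (g x)) addrC subr_gt0 (le_lt_trans _ (gm x))//.
  by rewrite -normrN ler_norm.
have qitv x : (q x)%:R <= (g x + m%:R) * N < (q x).+1%:R by exact: truncn_itv.
pose I := ((m + m) * n.+1)%N.
have qI x : (q x < I)%N.
  rewrite -(ltr_nat R); apply: le_lt_trans (proj1 (andP (qitv x))) _.
  rewrite /I natrM ltr_pM2r// natrD ltrD2r.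
  by apply: le_lt_trans (ler_norm _) (gm x).
pose B (i : 'I_I) := A `&` [set x | q x = i].
have mB i : measurable (B i).
  apply: measurableI; first exact: fA.1.
  rewrite (_ : [set x | q x = i] =
    (fun x => (g x + m%:R) * N) @^-1` `[(i : nat)%:R, (i : nat).+1%:R[).
    rewrite -[X in measurable X]setTI.
    have mgm : measurable_fun setT (fun x => (g x + m%:R) * N).
      by apply: measurable_funM => //; exact: measurable_funD.
    exact: mgm.
  apply/seteqP; split=> x /=; rewrite in_itv/=; first by move=> <-; exact: qitv.
  by rewrite -truncn_eq// => /eqP.
have fB i : finite_sets mu (B i).
  split=> //; apply: le_lt_trans fA.2; apply: le_measure; rewrite ?inE.
  - exact: mB.
  - exact: fA.1.
  - by move=> x [].
pose s x := \sum_(i < I) ((i : nat)%:R / N - m%:R) * \1_(B i) x.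
have Ds : Dfin mu s by exists I, (fun i => (i : nat)%:R / N - m%:R), B.
exists s => //.
have sE x : A x -> s x = (q x)%:R / N - m%:R.
  move=> Ax; rewrite /s (bigD1 (Ordinal (qI x)))//= big1 ?addr0.
    by rewrite indicE mem_set ?mulr1.
  move=> i iq; rewrite indicE memNset ?mulr0// => -[_ /= qi].
  by move/eqP: iq; apply; apply/val_inj.
have s0 x : ~ A x -> s x = 0.
  by move=> nA; rewrite /s big1// => i _; rewrite indicE memNset ?mulr0// => -[].
have gs x : `|(g \- s) x| <= N^-1 * \1_A x.
  rewrite indicE /=; have [Ax|nAx] := pselect (A x); last first.
    by rewrite memNset// s0// g0// subrr normr0 mulr0.
  rewrite mem_set// mulr1 sE//; have /andP[h1 h2] := qitv x.
  have -> : g x - ((q x)%:R / N - m%:R) = ((g x + m%:R) * N - (q x)%:R) / N.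
    by field; rewrite lt0r_neq0.
  rewrite ger0_norm; last by rewrite divr_ge0 ?subr_ge0// ltW.
  rewrite -[leRHS]mul1r ler_pM2r ?invr_gt0// lerBlDl ltW//.
  by rewrite natr1.
have mgs : measurable_fun setT (g \- s).
  by apply: measurable_funB => //; case: (Dfin_bfs Ds).
have iN0 : 0 <= N^-1 by rewrite invr_ge0 ltW.
have [_ h] := en_bound fA mgs iN0 gs.
apply: le_lt_trans h _; rewrite -/K.
apply: (@le_lt_trans _ _ (N^-1 * (K + 1))); first by rewrite ler_wpM2l// lerDl.
by rewrite -ltr_pdivlMr// ltr_wpDl.
Qed.

Lemma bfs_norm g : bounded_finite_support g -> bounded_finite_support (fun x => `|g x|).
Proof.
move=> [mg [M gM] [A fA g0]]; split.
- exact: measurableT_comp.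
- by exists M => x; rewrite normr_id.
- by exists A => // x nA; rewrite g0// normr0.
Qed.

(* [min (s n / K) 1] tends to [1] as [n] grows, at energy cost [C / K], so these
   cutoffs localize every function of finite energy. *)
Lemma recurrent_closure (s : nat -> V -> R) C :
  (forall n, bounded_finite_support (s n)) -> (forall n x, 0 <= s n x) ->
  (forall n, en (s n) <= C) ->
  {ae mu, forall x, forall M, \forall n \near \oo, M <= s n x} ->
  forall f, energy_space rho f -> energy_closure rho (Dfin mu) f.
Proof.
move=> bs s0 sC exh.
have C0 : 0 <= C by apply: le_trans (sC 0%N); exact: nrm_ge0.
have bounded f M : energy_space rho f -> (forall x, `|f x| <= M) ->
    energy_closure rho (Dfin mu) f.
  move=> Ef fM; have [mf Lf] := (energy_spaceP f).1 Ef.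
  apply: closure_limit => // e e0.
  pose M1 := `|M| + 1; have M10 : 0 < M1 by rewrite /M1 ltr_wpDl.
  have fM1 x : `|f x| <= M1.
    by apply: le_trans (fM x) _; apply: le_trans (ler_norm _) _; rewrite lerDl.
  (* [K] is fixed first, so that [M1 / K * C < e / 2] bounds the cost of the cutoff uniformly in
     [n]; only then is [n] chosen. *)
  have [j] := @ltr_add_invr R 0 (e / 2 / (M1 * (C + 1)))
    (divr_gt0 (divr_gt0 e0 (ltr0Sn _ 1)) (mulr_gt0 M10 (ltr_wpDl C0 ltr01))).
  rewrite add0r; set K : R := j.+1%:R => Ke.
  have K0 : 0 < K by rewrite ltr0n.
  pose z n x := Num.min (s n x / K) 1.
  have z0 n x : 0 <= z n x by rewrite /z le_min ler01 divr_ge0// ltW.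
  have z1 n x : z n x <= 1 by rewrite /z ge_min lexx orbT.
  have mz n : measurable_fun setT (z n).
    apply: measurable_minr => //; apply: measurable_funM => //.
    by case: (bs n).
  have zs n x y : `|z n x - z n y| <= K^-1 * `|s n x - s n y|.
    have -> : K^-1 * `|s n x - s n y| = `|s n x / K - s n y / K|.
      by rewrite -mulrBl normrM [`|K^-1|]ger0_norm ?invr_ge0 ?(ltW K0)// mulrC.
    exact: (nonexpansive_dist _ _ (@min_nonexpansive R 1)).1.
  (* Leibniz rule: the gradient of [f - f * z n] is [P n - Q n]. The term [P n] tends to 0 by
     dominated convergence, and [Q n] is small by the choice of [K]. *)
  pose P n (w : V * V) := (1 - z n w.1) * grad f w.
  pose Q n (w : V * V) := f w.2 * grad (z n) w.
  have mP n : measurable_fun setT (P n).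
    apply: measurable_funM; last exact: Lf.1.
    apply: measurable_funB => //; apply: measurableT_comp (mz n) _.
    exact: measurable_fst.
  have mQ n : measurable_fun setT (Q n).
    apply: measurable_funM; last exact: measurable_grad.
    by apply: measurableT_comp mf _; exact: measurable_snd.
  have Pf n w : `|P n w| <= `|grad f w|.
    rewrite normrM ler_piMl// ger0_norm ?subr_ge0//.
    by rewrite gerBl.
  have Ls n : L2 rho (grad (s n)) by exact: ((energy_spaceP _).1 (bfs_energy (bs n))).2.
  have Qs n w : `|Q n w| <= `|(M1 / K) * grad (s n) w|.
    rewrite normrM (_ : `|M1 / K * grad (s n) w| = M1 * (K^-1 * `|grad (s n) w|)).
      by rewrite ler_pM//; exact: zs.
    by rewrite !normrM [`|M1|]ger0_norm ?ltW// [`|K^-1|]ger0_norm ?invr_ge0 ?ltW// mulrA.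
  have LP n : L2 rho (P n) by exact: L2_le (mP n) (Pf n) Lf.
  have LQs n := nrm_scale (M1 / K) (Ls n).
  have LQ n : L2 rho (Q n) by exact: L2_le (mQ n) (Qs n) (LQs n).1.
  have nQ n : nrm rho (Q n) < e / 2.
    apply: le_lt_trans (nrm_le (mQ n) (Qs n) (LQs n).1) _.
    apply: le_lt_trans (LQs n).2 _.
    rewrite ger0_norm; last by rewrite divr_ge0// ltW.
    apply: (@le_lt_trans _ _ (K^-1 * (M1 * (C + 1)))).
      rewrite [M1 / K]mulrC -mulrA ler_wpM2l ?invr_ge0 ?(ltW K0)//.
      rewrite ler_wpM2l ?(ltW M10)//.
      by apply: le_trans (sC n) _; rewrite lerDl.
    by rewrite -ltr_pdivlMr ?mulr_gt0// ltr_wpDl.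
  have P0 : nrm rho (P n) @[n --> \oo] --> 0.
    apply: nrm_dominated Lf mP Pf _.
    apply: filterS (ae_pair exh) => w [hw _].
    apply: cvg_near_cst; apply: filterS (hw K) => n Kn.
    rewrite /P /z (_ : Num.min _ _ = 1) ?subrr ?mul0r//.
    by apply/min_idPr; rewrite ler_pdivlMr// mul1r.
  have [n nP] : exists n, nrm rho (P n) < e / 2.
    have /cvgrPdist_lt/(_ (e / 2) (divr_gt0 e0 (ltr0Sn _ 1)))[n _ h] := P0.
    exists n; have := h n (leqnn n); rewrite sub0r normrN ger0_norm//.
    exact: nrm_ge0.
  pose g x := f x * z n x.
  exists g.
    apply: bfs_closure; split.
    - exact: measurable_funM.
    - exists M1 => x; rewrite normrM; apply: le_trans (fM1 x).
      by rewrite ler_piMr// ger0_norm.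
    - have [_ _ [A fA sA]] := bs n; exists A => // x nA.
      by rewrite /g /z sA// mul0r min_l ?mulr0.
  rewrite (_ : grad (f \- g) = fun w => - 1 * Q n w + P n w).
    apply: le_lt_trans (nrm_scaleD _ (LQ n) (LP n)) _.
    by rewrite normrN1 mul1r [ltRHS]splitr ltrD.
  by apply/funext => w; rewrite /grad /g /Q /P /= /grad; ring.
move=> f Ef; have [mf Lf] := (energy_spaceP f).1 Ef.
apply: closure_limit => // e e0.
(* Reduction to bounded functions: the gradient of [f - T n] is dominated by that of [f], and at
   each pair it vanishes once [n] exceeds both values of [|f|]. *)
pose T n x := Num.max (- n%:R) (Num.min (f x) n%:R).
have mT n : measurable_fun setT (T n).
  by apply: measurable_maxr => //; exact: measurable_minr.
have Tn n x : `|T n x| <= n%:R.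
  have n0 : 0 <= n%:R :> R by [].
  rewrite ler_norml /T le_max lexx/= ge_max; apply/andP; split; first by lra.
  by rewrite ge_min lexx orbT.
have Tf n x y : `|T n x - T n y| <= `|f x - f y| /\
    `|(f x - T n x) - (f y - T n y)| <= `|f x - f y|.
  exact: nonexpansive_dist _ _ (@clamp_nonexpansive R n%:R).
have ET n : energy_space rho (T n).
  exact: (energy_contraction Ef (mT n) (fun x y => (Tf n x y).1)).1.
have c0 : nrm rho (grad (f \- T n)) @[n --> \oo] --> 0.
  apply: nrm_dominated Lf _ _ _.
  - by move=> n; apply: measurable_grad; exact: measurable_funB.
  - by move=> n w; exact: (Tf n w.1 w.2).2.
  apply: aeW => w; apply: cvg_near_cst.
  exists (Num.truncn `|f w.1| + Num.truncn `|f w.2|).+1 => // n /= hn.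
  have TE x : `|f x| <= n%:R -> T n x = f x.
    rewrite ler_norml => /andP[h1 h2].
    by rewrite /T min_l// max_r.
  rewrite /grad /= !TE ?subrr//.
    apply: le_trans (ltW (truncnS_gt _)) _; rewrite ler_nat.
    by apply: leq_trans hn; rewrite ltnS leq_addl.
  apply: le_trans (ltW (truncnS_gt _)) _; rewrite ler_nat.
  by apply: leq_trans hn; rewrite ltnS leq_addr.
have /cvgrPdist_lt/(_ e e0)[n _ h] := c0.
exists (T n); first exact: bounded (ET n) (Tn n).
by have := h n (leqnn n); rewrite sub0r normrN ger0_norm// nrm_ge0.
Qed.

(** * Projection on the closure of [Dfin] *)

Lemma Dfin_minimizing f : energy_space rho f -> exists g_ : nat -> V -> R,
  [/\ forall n, Dfin mu (g_ n),
    forall n j, (n <= j)%N -> en (g_ j \- g_ n) <= 2 / 2 ^+ n &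
    forall n v, Dfin mu v ->
      `|ip rho (grad (f \- g_ n)) (grad v)| <= en v / 2 ^+ n].
Proof.
move=> Ef; have [mf Lf] := (energy_spaceP f).1 Ef.
pose q v := ip rho (grad (f \- v)) (grad (f \- v)).
pose S := [set r | exists2 v, Dfin mu v & r = q v].
have S0 : S !=set0 by exists (q (fun=> 0)), (fun=> 0); [exact: Dfin0|].
have lbS : has_lbound S by exists 0 => _ [v _ ->]; exact: ip_ge0.
have hS : has_inf S by [].
pose del := inf S.
have qdel v : Dfin mu v -> del <= q v by move=> Dv; apply: ge_inf => //; exists v.
have e_gt0 n : 0 < (2 ^+ n)^-1 ^+ 2 :> R by rewrite exprn_gt0// invr_gt0 exprn_gt0.
have exg n : exists v, Dfin mu v /\ q v < del + (2 ^+ n)^-1 ^+ 2.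
  have [_ [v Dv ->] qv] := inf_adherent (e_gt0 n) hS.
  by exists v.
have [g_ gP] := choice exg.
have Dg n := (gP n).1.
have Lsub v : Dfin mu v -> L2 rho (grad (f \- v)).
  move=> Dv; apply: ((energy_spaceP _).1 _).2.
  by apply: energy_sub => //; exact: bfs_energy (Dfin_bfs Dv).
have LD v : Dfin mu v -> L2 rho (grad v).
  by move=> Dv; exact: ((energy_spaceP _).1 (bfs_energy (Dfin_bfs Dv))).2.
(* Comparison of [g_ n] with its competitor [g_ n - t * v]. This quadratic in [t] stays nonnegative,
   and its discriminant is the last claim. *)
have var n v t : Dfin mu v ->
    0 <= (2 ^+ n)^-1 ^+ 2 + t ^+ 2 * ip rho (grad v) (grad v)
      + 2 * t * ip rho (grad (f \- g_ n)) (grad v).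
  move=> Dv; have Dw : Dfin mu (fun x => - t * v x + g_ n x) by exact: Dfin_comb.
  have := qdel _ Dw; have := (gP n).2; rewrite /q.
  rewrite (_ : grad (f \- (fun x => - t * v x + g_ n x)) =
    fun w => t * grad v w + grad (f \- g_ n) w); last first.
    by apply/funext => w; rewrite /grad /=; ring.
  rewrite ip_comb_sqr//; [|exact: LD|exact: Lsub].
  by rewrite [ip rho (grad v) (grad (f \- g_ n))]ipC; lra.
exists g_; split => //.
- move=> n j nj; have h2 : 0 < (2 ^+ n : R)^-1 by rewrite invr_gt0 exprn_gt0.
  have jn : (2 ^+ j : R)^-1 <= (2 ^+ n)^-1.
    by rewrite lef_pV2 ?posrE ?exprn_gt0// ler_weXn2l// ler1n.
  rewrite -(ler_pXn2r (ltn0Sn 1)) ?nnegrE ?nrm_ge0//.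
  (* The midpoint of [g_ n] and [g_ j] is a competitor, so its distance to [f] is at least [del].
     The parallelogram law then bounds the squared increment by [2 * 4^(-j) + 2 * 4^(-n)], at most
     [4 * 4^(-n)]. *)
  have Dmid : Dfin mu (fun x => 2^-1 * g_ n x + (2^-1 * g_ j x + 0)).
    by apply: Dfin_comb => //; apply: Dfin_comb => //; exact: Dfin0.
  have := qdel _ Dmid; have := (gP n).2; have := (gP j).2; rewrite /q.
  rewrite (_ : grad (f \- (fun x => 2^-1 * g_ n x + (2^-1 * g_ j x + 0))) =
    fun w => 2^-1 * (1 * grad (f \- g_ j) w + grad (f \- g_ n) w)); last first.
    by apply/funext => w; rewrite /grad /=; field.
  rewrite nrm_sqr (_ : grad (g_ j \- g_ n) =
    fun w => - 1 * grad (f \- g_ j) w + grad (f \- g_ n) w); last first.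
    by apply/funext => w; rewrite /grad /=; ring.
  rewrite parallelogram; [|exact: Lsub|exact: Lsub].
  have : (2 ^+ j : R)^-1 ^+ 2 <= (2 ^+ n)^-1 ^+ 2.
    by apply: lerXn2r => //; rewrite nnegrE ltW// invr_gt0 exprn_gt0.
  by rewrite exprMn; lra.
- move=> n v Dv; have h2 : 0 < (2 ^+ n : R)^-1 by rewrite invr_gt0 exprn_gt0.
  rewrite -(ler_pXn2r (ltn0Sn 1)) ?nnegrE//; last by rewrite mulr_ge0 ?nrm_ge0 ?ltW.
  rewrite real_normK ?num_real// exprMn nrm_sqr.
  apply: quadratic_ge0_discriminant; first exact: ip_ge0.
  by move=> t; apply: le_trans (var n v t Dv) _; lra.
Qed.

(** The bound may be taken to be a natural number, which makes the union countable. *)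
Lemma measurable_bounded_orbit (s : nat -> V -> R) :
  (forall n, measurable_fun setT (s n)) ->
  measurable [set x | exists M, forall n, s n x <= M].
Proof.
move=> ms.
rewrite (_ : [set _ | _] =
    \bigcup_m \bigcap_n ([set: V] `&` [set x | ((s n x)%:E <= (m%:R : R)%:E)%E])).
  apply: bigcupT_measurable => m; apply: bigcapT_measurable => n.
  by apply: emeasurable_fun_infty_c => //; exact/measurable_EFinP.
apply/seteqP; split=> x /=.
  move=> [M sM]; exists (Num.truncn `|M|).+1 => // n _; split=> //=.
  rewrite lee_fin (le_trans (sM n))// (le_trans (ler_norm _))// ltW//.
  exact: truncnS_gt.
by move=> [m _ h]; exists m%:R => n; have [_] := h n Logic.I; rewrite /= lee_fin.
Qed.

Lemma cvg_absolute_telescope (u : nat -> R) M :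
  (forall n, \sum_(i < n) `|u i.+1 - u i| <= M) -> cvgn u.
Proof.
move=> uM.
have : cvgn (series (fun i => u i.+1 - u i)).
  apply: normed_cvg; apply: nondecreasing_is_cvgn.
    by apply: nondecreasing_series => i _ _; exact: normr_ge0.
  exists M => _ [n _ <-].
    by have := uM n; rewrite -(big_mkord xpredT (fun i => `|u i.+1 - u i|)).
move=> cs; have : cvgn (fun n => u 0%N + series (fun i => u i.+1 - u i) n).
  by apply: is_cvgD => //; exact: is_cvg_cst.
rewrite (_ : (fun n => _) = u)//.
by apply/funext => n; rewrite /series/= telescope_sumr// addrC subrK.
Qed.

Lemma energy_projection f : energy_space rho f ->
  exists2 g, energy_closure rho (Dfin mu) g &
    forall v, Dfin mu v -> ip rho (grad (f \- g)) (grad v) = 0.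
Proof.
move=> Ef; have [g_ [Dg cauchy orth]] := Dfin_minimizing Ef.
have bg n := Dfin_bfs (Dg n); have Eg n := bfs_energy (bg n).
have mg n : measurable_fun setT (g_ n) by case: (bg n).
pose del n := g_ n.+1 \- g_ n.
have bdel n : bounded_finite_support (del n).
  rewrite /del (_ : _ \- _ = fun x => - 1 * g_ n x + g_ n.+1 x); first exact: bfs_comb.
  by apply/funext => x /=; ring.
have Ldel n : L2 rho (grad (del n)) by exact: ((energy_spaceP _).1 (bfs_energy (bdel n))).2.
have sum_en n : \sum_(i < n) en (del i) <= 4.
  (* Exact value of the geometric sum of the bounds [2 / 2 ^+ i], so that the induction closes. *)
  apply: (@le_trans _ _ (4 - 4 / 2 ^+ n)); last by rewrite gerBl divr_ge0// exprn_ge0.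
  elim: n => [|n IH]; first by rewrite big_ord0 expr0 divr1 subrr.
  rewrite big_ord_recr/= exprS invfM.
  have := cauchy n n.+1 (leqnSn n); rewrite -/(del n).
  by move: IH; set a := _^-1; lra.
pose s n x := \sum_(i < n) `|del i x|.
have bs n : bounded_finite_support (s n) /\ en (s n) <= \sum_(i < n) en (del i).
  elim: n => [|n [b e]].
    rewrite (_ : s 0%N = fun=> 0).
      by rewrite grad0E nrm_cst0 big_ord0; split=> //; exact: bfs0.
    by apply/funext => x; rewrite /s big_ord0.
  have bn := bfs_norm (bdel n).
  have mdn : measurable_fun setT (fun x => `|del n x|) by case: bn.
  have [En nen] := energy_contraction (bfs_energy (bdel n)) mdn
    (fun x y => ler_dist_dist (del n x) (del n y)).
  rewrite (_ : s n.+1 = fun x => 1 * s n x + `|del n x|).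
    split; first exact: bfs_comb.
    rewrite grad_comb big_ord_recr/=.
    have Lb := ((energy_spaceP _).1 (bfs_energy b)).2.
    have Ldn := ((energy_spaceP _).1 En).2.
    by apply: le_trans (nrm_scaleD _ Lb Ldn) _; rewrite normr1 mul1r lerD.
  by apply/funext => x; rewrite /s big_ord_recr/= mul1r.
have ms n : measurable_fun setT (s n) by case: (bs n).1.
have nds x : {homo (s ^~ x) : a b / (a <= b)%N >-> a <= b}.
  by apply: homo_leq => // [u v w|n]; [exact: le_trans|rewrite /s big_ord_recr/= lerDl].
pose G := [set x | exists M, forall n, s n x <= M].
have mG : measurable G by exact: measurable_bounded_orbit.
(* The double complement is the form in which [ergodic] is applied, to the complement of [G]. At
   almost every pair [s n y] exceeds [s n x] by at most a convergent sum of gradients, so [y] is in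
   [G] when [x] is. *)
have rG : rho (~` ~` G `*` ~` G) = 0%E.
  have [N [mN N0 sN]] := L2_summable_ae Ldel sum_en.
  apply/negligibleP; first exact: measurableX (measurableC (measurableC mG)) (measurableC mG).
  exists N; split=> // -[x y] /= [Gx nGy]; apply: sN => /= -[M hM].
  move: Gx => /contrapT[M' hM']; apply: nGy; exists (M' + M) => n.
  apply: le_trans (lerD (hM' n) (hM n)); rewrite -big_split/=; apply: ler_sum => i _.
  have := ler_normB (del i x) (grad (del i) (x, y)).
  by rewrite /grad /= subKr.
have [G0|G0] := ergodic (measurableC mG) rG.
- have aeG : {ae mu, forall x, G x} by exists (~` G); split=> //; exact: measurableC.
  (* Cutting to [G] makes the sequence converge at every point, so that its limit is measurable. *)
  pose g' n x := g_ n x * \1_G x.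
  have mg' n : measurable_fun setT (g' n).
    by apply: measurable_funM => //; exact: measurable_indic.
  have cg' x : cvgn (g' ^~ x).
    rewrite /g' indicE; have [Gx|nGx] := pselect (G x); last first.
      rewrite memNset//; under eq_fun do rewrite mulr0.
      exact: is_cvg_cst.
    rewrite mem_set//; under eq_fun do rewrite mulr1.
    by have [M hM] := Gx; exact: cvg_absolute_telescope hM.
  pose g x := limn (g' ^~ x).
  have mfg : measurable_fun setT g.
    by apply: (measurable_fun_cvg mg') => x _; exact: cg'.
  have cg : {ae mu, forall x, g_ n x @[n --> \oo] --> g x}.
    apply: filterS aeG => x Gx.
    have := cg' x; rewrite -/(g x).
    rewrite /g (_ : g' ^~ x = g_ ^~ x)//.
    by apply/funext => n; rewrite /g' indicE mem_set// mulr1.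
  (* Fatou along [j], applied to the differences [g_ (n + j) - g_ n], whose norms are at most
     [2 / 2 ^+ n]. *)
  have Egn n : energy_space rho (g \- g_ n) /\ en (g \- g_ n) <= 2 / 2 ^+ n.
    have mgn : measurable_fun setT (g \- g_ n) by exact: measurable_funB.
    have [|||||L e] := @nrm_fatou _ _ _ rho
      (fun j => grad (g_ (n + j)%N \- g_ n)) (grad (g \- g_ n)) (2 / 2 ^+ n).
    - by rewrite divr_ge0// exprn_ge0.
    - by move=> j; exact: ((energy_spaceP _).1 (energy_sub (Eg _) (Eg _))).2.
    - by move=> j; apply: cauchy; exact: leq_addr.
    - exact: measurable_grad.
    - apply: filterS (ae_pair cg) => w [c1 c2]; rewrite /grad /=.
      by apply: cvgB; apply: cvgB; try exact: cvg_cst;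
        apply: (cvg_comp _ _ _ c1) || apply: (cvg_comp _ _ _ c2); exact: cvg_addnl.
    by split=> //; apply/energy_spaceP.
  have Egg : energy_space rho g.
    rewrite (_ : g = fun x => 1 * (g \- g_ 0%N) x + g_ 0%N x).
      by apply: energy_comb => //; exact: (Egn 0%N).1.
    by apply/funext => x /=; ring.
  have small (C e : R) : 0 < e -> exists n, C / 2 ^+ n < e.
    move=> e0; have /cvgrPdist_lt/(_ e e0)[n _ h] : (C * (2^-1) ^+ n) @[n --> \oo] --> C * 0.
      apply: cvgMr; apply: cvg_expr.
      by rewrite ger0_norm ?invr_ge0// invf_lt1// ltr1n.
    exists n; have := h n (leqnn n); rewrite mulr0 sub0r normrN exprVn.
    by apply: le_lt_trans; exact: ler_norm.
  exists g.
    apply/energy_closureP; split=> // e e0; have [n ne] := small 2 e e0.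
    by exists (g_ n) => //; apply: le_lt_trans ne; exact: (Egn n).2.
  move=> v Dv; apply/eqP; rewrite -normr_eq0 eq_le normr_ge0 andbT.
  apply/ler_addgt0Pr => e e0; rewrite add0r.
  (* The first summand bounds the defect of orthogonality of [f - g_ n] to [v], the second the
     replacement of [g_ n] by [g]. *)
  have [n ne] := small (en v + 2 * en v) e e0.
  apply: ltW; apply: le_lt_trans ne.
  have Lv : L2 rho (grad v) by exact: ((energy_spaceP _).1 (bfs_energy (Dfin_bfs Dv))).2.
  have Lg := ((energy_spaceP _).1 (Egn n).1).2.
  have Lfg := ((energy_spaceP _).1 (energy_sub Ef (Eg n))).2.
  rewrite (_ : grad (f \- g) =
    fun w => - 1 * grad (g \- g_ n) w + grad (f \- g_ n) w); last first.
    by apply/funext => w; rewrite /grad /=; ring.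
  rewrite ip_comb// mulN1r; apply: le_trans (ler_normD _ _) _; rewrite normrN addrC mulrDl.
  apply: lerD; first exact: orth.
  apply: le_trans (cauchy_schwarz Lg Lv) _.
  rewrite [2 * _]mulrC -mulrA mulrC ler_wpM2l ?nrm_ge0//; exact: (Egn n).2.
- exists f; last first.
    move=> v Dv; rewrite (_ : grad (f \- f) = fun=> 0).
      exact: ip0l.
    by apply/funext => w; rewrite /grad /= !subrr.
  apply: (@recurrent_closure s 4) => //.
  - by move=> n; exact: (bs n).1.
  - by move=> n x; apply: sumr_ge0.
  - by move=> n; apply: le_trans (bs n).2 (sum_en n).
  have aeG : {ae mu, forall x, ~ G x}.
    by rewrite setCK in G0; exists G; split=> // x /= /contrapT.
  apply: filterS aeG => x nGx M.
  (* The sums [s n x] are nondecreasing in [n], so passing [M] once means staying above it. *)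
  apply: contrapT => h; apply: nGx; exists M => n; rewrite leNgt; apply/negP => Mn.
  by apply: h; exists n => // j /= nj; apply: le_trans (nds x _ _ nj); exact: ltW.
Qed.

(** * Orthogonality of the two subspaces and their intersection *)

Lemma Dfin_harmonic_orthogonal v h : Dfin mu v -> harmonic_energy mu rho k h ->
  ip rho (grad v) (grad h) = 0.
Proof.
move=> [n [a [A [fA ->]]]] Hh; have Eh := Hh.1; have [_ Lh] := (energy_spaceP h).1 Eh.
elim: n a A fA => [|n IH] a A fA.
  rewrite (_ : grad _ = fun=> 0); last first.
    by apply/funext => w; rewrite /grad !big_ord0 subrr.
  exact: ip0l.
have L (j : nat) (b : 'I_j -> R) (B : 'I_j -> set V) : (forall i, finite_sets mu (B i)) ->
    L2 rho (grad (fun x => \sum_(i < j) b i * \1_(B i) x)).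
  move=> fB; apply: ((energy_spaceP _).1 _).2; apply: bfs_energy; apply: Dfin_bfs.
  by exists j, b, B.
rewrite (_ : (fun x => _) = fun x => a ord0 * \1_(A ord0) x +
  \sum_(i < n) a (lift ord0 i) * \1_(A (lift ord0 i)) x); last first.
  by apply/funext => x; rewrite big_ord_recl.
rewrite grad_comb ip_comb//.
- rewrite IH; last by move=> i; exact: fA.
  have := (harmonicP Eh).1 Hh _ (fA ord0); rewrite energy_innerE => /eqP.
  rewrite mulf_eq0 invr_eq0 pnatr_eq0/= => /eqP ->.
  by rewrite mulr0 addr0.
- exact: ((energy_spaceP _).1 (bfs_energy (bfs_indic (fA ord0)))).2.
- by apply: L => i; exact: fA.
Qed.

Lemma closure_harmonic_orthogonal g h : energy_closure rho (Dfin mu) g ->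
  harmonic_energy mu rho k h -> ip rho (grad g) (grad h) = 0.
Proof.
move=> /energy_closureP[Eg ge] Hh.
have [_ Lh] := (energy_spaceP h).1 Hh.1.
apply/eqP; rewrite -normr_eq0 eq_le normr_ge0 andbT.
apply/ler_addgt0Pr => e e0; rewrite add0r.
have h1 : 0 < en h + 1 by rewrite ltr_wpDl// nrm_ge0.
have [|v Dv gv] := ge (e / (en h + 1)); first by rewrite divr_gt0.
have Ev := bfs_energy (Dfin_bfs Dv); have [_ Lv] := (energy_spaceP v).1 Ev.
have [_ Lgv] := (energy_spaceP _).1 (energy_sub Eg Ev).
rewrite (_ : grad g = fun w => 1 * grad (g \- v) w + grad v w); last first.
  by apply/funext => w; rewrite /grad /=; ring.
rewrite ip_comb// mul1r (Dfin_harmonic_orthogonal Dv Hh) addr0.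
apply: le_trans (cauchy_schwarz Lgv Lh) _.
apply: (@le_trans _ _ (e / (en h + 1) * (en h + 1))); last by rewrite divfK// lt0r_neq0.
by rewrite ler_pM ?nrm_ge0// ?ltW// ltrDl.
Qed.

Lemma energy_eq_en f g v : energy_space rho f -> energy_space rho g ->
  energy_space rho v -> energy_eq mu f g -> en (g \- v) = en (f \- v).
Proof.
move=> Ef Eg Ev fg.
have [mfv Lfv] := (energy_spaceP _).1 (energy_sub Ef Ev).
have [mgv Lgv] := (energy_spaceP _).1 (energy_sub Eg Ev).
have E : {ae rho, forall w, grad (f \- v) w = grad (g \- v) w}.
  by apply: filterS (energy_eq_grad fg) => w; rewrite /grad /=; lra.
have [_ h] := ae_eq_L2 Lfv Lgv.1 E.
by rewrite /nrm h// ipC h.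
Qed.

Lemma energy_subspace_closure : energy_subspace mu rho (energy_closure rho (Dfin mu)).
Proof.
split.
- by move=> f [].
- by apply: bfs_closure; exact: bfs0.
- move=> a f g /energy_closureP[Ef fe] /energy_closureP[Eg ge].
  apply/energy_closureP; split; first exact: energy_comb.
  move=> e e0; have a1 : 0 < `|a| + 1 by rewrite ltr_wpDl.
  have [|u Du fu] := fe (e / 2 / (`|a| + 1)); first by rewrite !divr_gt0.
  have [|v Dv gv] := ge (e / 2); first by rewrite divr_gt0.
  exists (fun x => a * u x + v x); first exact: Dfin_comb.
  have Eu := bfs_energy (Dfin_bfs Du); have Ev := bfs_energy (Dfin_bfs Dv).
  have [_ Lu] := (energy_spaceP _).1 (energy_sub Ef Eu).
  have [_ Lv] := (energy_spaceP _).1 (energy_sub Eg Ev).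
  rewrite (_ : grad _ = fun w => a * grad (f \- u) w + grad (g \- v) w); last first.
    by apply/funext => w; rewrite /grad /=; ring.
  apply: le_lt_trans (nrm_scaleD _ Lu Lv) _; rewrite [ltRHS]splitr ler_ltD//.
  apply: (@le_trans _ _ ((`|a| + 1) * en (f \- u))).
    by rewrite ler_wpM2r ?nrm_ge0// lerDl.
  by rewrite mulrC -ler_pdivlMr// ltW.
- move=> f g /energy_closureP[Ef fe] Eg fg; apply/energy_closureP; split=> // e e0.
  have [v Dv fv] := fe e e0; exists v => //.
  by rewrite (energy_eq_en Ef Eg _ fg)//; exact: bfs_energy (Dfin_bfs Dv).
Qed.

(** Through [harmonicP], linearity and saturation are read off inner products, which avoids adding
    extended-real Laplacians whose integrals may diverge. *)
Lemma energy_subspace_harmonic : energy_subspace mu rho (harmonic_energy mu rho k).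
Proof.
have LA A : finite_sets mu A -> L2 rho (grad \1_A).
  by move=> fA; exact: ((energy_spaceP _).1 (bfs_energy (bfs_indic fA))).2.
split.
- by move=> f [].
- apply/harmonicP; first exact: energy0.
  by move=> A fA; rewrite energy_innerE grad0E ipC ip0l mulr0.
- move=> a f g Hf Hg; have Ef := Hf.1; have Eg := Hg.1.
  apply/harmonicP; first exact: energy_comb.
  move=> A fA; rewrite energy_innerE grad_comb ip_combr.
  + have := (harmonicP Ef).1 Hf A fA; have := (harmonicP Eg).1 Hg A fA.
    by rewrite !energy_innerE mulrDr mulrCA => -> ->; rewrite mulr0 addr0.
  + exact: ((energy_spaceP _).1 Ef).2.
  + exact: ((energy_spaceP _).1 Eg).2.
  + exact: LA.
- move=> f g Hf Eg fg; have Ef := Hf.1; apply/harmonicP => // A fA.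
  rewrite -((harmonicP Ef).1 Hf A fA) !energy_innerE ipC [in RHS]ipC.
  have [mf Lf] := (energy_spaceP f).1 Ef; have [mg Lg] := (energy_spaceP g).1 Eg.
  by rewrite (ae_eq_L2 Lf Lg.1 (energy_eq_grad fg)).2//; exact: LA.
Qed.

(** The class of [u] lies in both subspaces, so it is orthogonal to itself and its gradient vanishes
    [rho]-a.e.; irreducibility then makes [u] constant. *)
Lemma closure_harmonic_unique u v : energy_closure rho (Dfin mu) u ->
  harmonic_energy mu rho k v -> energy_eq mu u v -> energy_eq mu u (fun=> 0).
Proof.
move=> Su Tv uv; have [Eu _] := (energy_closureP u).1 Su.
have [mu_ Lu] := (energy_spaceP u).1 Eu; have [mv Lv] := (energy_spaceP v).1 Tv.1.
have u0 : nrm rho (grad u) = 0.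
  have := closure_harmonic_orthogonal Su Tv.
  rewrite ipC (ae_eq_L2 Lu Lv.1 (energy_eq_grad uv)).2// => h.
  by rewrite /nrm h sqrtr0.
have [|c uc] := ae_pair_const mu_.
  by apply: filterS (nrm0_ae Lu u0) => w; rewrite /grad; lra.
by exists c; apply: filterS uc => x ->; rewrite subr0.
Qed.

End Disintegration.

Theorem theorem3p10 (R : realType) (d : measure_display) (V : measurableType d)
    (mu : {measure set V -> \bar R}) (rho : {measure set (V * V) -> \bar R})
    (k : R.-ker V ~> V)
    (V_standard : standard_borel R V)
    (V_uncountable : ~ countable [set: V])
    (mu_sigma_finite : sigma_finite [set: V] mu)
    (mu_nonatomic : nonatomic mu)
    (rho_sigma_finite : sigma_finite [set: V * V] rho)
    (rho_symmetric : symmetric_measure rho)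
    (rho_disintegrates : disintegrates rho mu k)
    (assumption1 : locally_finite_degree mu k)
    (rho_irreducible : irreducible_kernel mu k)
    (assumption2 : forall f, energy_space rho f ->
                     locally_square_integrable mu f) :
  orthogonal_decomposition mu rho
    (energy_closure rho (Dfin mu)) (harmonic_energy mu rho k).
Proof.
have subS : energy_subspace mu rho (energy_closure rho (Dfin mu)).
  exact: (energy_subspace_closure mu_sigma_finite rho_symmetric rho_disintegrates
    assumption1).
have subT : energy_subspace mu rho (harmonic_energy mu rho k).
  exact: (energy_subspace_harmonic mu_sigma_finite rho_symmetric rho_disintegrates
    assumption1).
split=> //.
- move=> g h Sg Th; rewrite energy_innerE.
  by rewrite (closure_harmonic_orthogonal mu_sigma_finite rho_symmetric
    rho_disintegrates assumption1 Sg Th) mulr0.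
- move=> f Ef.
  have [g Sg gf] := energy_projection mu_sigma_finite rho_symmetric rho_disintegrates
    assumption1 rho_irreducible Ef.
  exists g, (f \- g); split=> //.
    have Efg : energy_space rho (f \- g) by apply: energy_sub => //; exact: Sg.1.
    apply/(harmonicP mu_sigma_finite rho_symmetric rho_disintegrates assumption1) => // A fA.
    by rewrite energy_innerE ipC gf ?mulr0//; exact: Dfin_indic.
  by exists 0; apply: aeW => x /=; ring.
move=> g h g' h' Sg Th Sg' Th' [c gh].
have [_ _ combS _] := subS; have [_ _ combT _] := subT.
(* Up to a constant, [g - g'] in the first subspace equals [h' - h] in the second. *)
have [|c' gg'] := closure_harmonic_unique mu_sigma_finite rho_symmetric
    rho_disintegrates assumption1 rho_irreducible (combS (- 1) _ _ Sg' Sg)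
    (combT (- 1) _ _ Th Th').
  by exists c; apply: filterS gh => x /=; lra.
split; first by exists c'; apply: filterS gg' => x; lra.
by exists (c - c'); apply: filterS2 gh gg' => x /=; lra.
Qed.
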